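(* Let $T_n^1$ and $T_n^2$ be two independent uniform attachment trees with $n$ vertices each, and let $X_n$ be the number of vertices of their largest common (unlabeled) subtree. Then $$\lim_{n\to\infty}\mathbb{P}\left(X_n \geq n^{0.83}\right) = 1 .$$
   Context: A uniform attachment tree (random recursive tree) is defined recursively: $T_1$ is a single vertex, and given $T_n$, the tree $T_{n+1}$ is obtained by adding one new vertex and joining it by a single edge to a vertex of $T_n$ chosen uniformly at random, independently of everything else. For two finite trees $T^1,T^2$ (viewed as unlabeled, unrooted graphs), the size of their largest common subtree is the maximum of $|S|$ (number of vertices of $S$) over all trees $S$ such that $S$ is isomorphic to a subtree (connected subgraph) of $T^1$ and to a subtree of $T^2$; $X_n$ is this quantity for $T_n^1$ and $T_n^2$. *)

(* Defs.v *)
From mathcomp Require Import all_boot all_order all_algebra.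
From mathcomp Require Import all_classical all_reals all_analysis.

Set Implicit Arguments.
Unset Strict Implicit.
Unset Printing Implicit Defensive.

Import Order.TTheory GRing.Theory Num.Theory.
Import numFieldNormedType.Exports.

Local Open Scope classical_set_scope.
Local Open Scope ring_scope.

(* A graph on the vertex set V is given by its adjacency relation [e : rel V]. *)

Definition acyclic (V : finType) (e : rel V) : Prop :=
  forall c : seq V, ucycle e c -> (size c < 3)%N.

Definition is_tree (V : finType) (e : rel V) : Prop :=
  [/\ symmetric e, irreflexive e, (0 < #|V|)%N,
      (forall x y : V, connect e x y) & acyclic e].

(* (W, F) is a nonempty connected subgraph of e, not necessarily induced. *)
Definition is_subtree (V : finType) (e : rel V) (W : {set V}) (F : rel V) :
    Prop :=
  [/\ symmetric F, subrel F e, (forall x y : V, F x y -> x \in W /\ y \in W),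
      (0 < #|W|)%N & (forall x y : V, x \in W -> y \in W -> connect F x y)].

Definition isomorphic_to (U V : finType) (s : rel U) (W : {set V}) (F : rel V) :
    Prop :=
  exists f : U -> V,
    [/\ injective f, W =i codom f & forall x y : U, F (f x) (f y) = s x y].

Definition has_subtree_copy (U V : finType) (s : rel U) (e : rel V) : Prop :=
  exists (W : {set V}) (F : rel V), is_subtree e W F /\ isomorphic_to s W F.

Definition is_common_subtree (U V1 V2 : finType) (s : rel U) (e1 : rel V1)
    (e2 : rel V2) : Prop :=
  [/\ is_tree s, has_subtree_copy s e1 & has_subtree_copy s e2].

(* The bound on k loses nothing: isomorphisms are injective on vertices. *)
Definition largest_common_subtree (V1 V2 : finType) (e1 : rel V1)
    (e2 : rel V2) : nat :=
  \max_(k < #|V1|.+1 | `[< exists (U : finType) (s : rel U),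
                             #|U| = k /\ is_common_subtree s e1 e2 >]) k.

(* [lift ord_max] embeds the n old vertices; ord_max is the new vertex. *)
Definition attach (n : nat) (e : rel 'I_n) (v : 'I_n) : rel 'I_n.+1 :=
  fun x y =>
    match unlift ord_max x, unlift ord_max y with
    | Some x', Some y' => e x' y'
    | Some x', None => x' == v
    | None, Some y' => y' == v
    | None, None => false
    end.

(* The random objects below take finitely many values, so their target types
   carry the discrete sigma-algebra. *)
Definition discrete_measurable (d : measure_display) (Omega : measurableType d)
    (E : Type) (X : Omega -> E) : Prop :=
  forall A : set E, measurable (X @^-1` A).

Definition mutually_independent (R : realType) (d : measure_display)
    (Omega : measurableType d) (P : probability Omega R) (I : choiceType)
    (E : I -> Type) (X : forall i, Omega -> E i) : Prop :=
  forall (J : seq I) (A : forall i, set (E i)), uniq J ->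
    P (\bigcap_(i in [set` J]) (X i @^-1` A i)) =
    (\prod_(i <- J) P (X i @^-1` A i))%E.

Definition independent (R : realType) (d : measure_display)
    (Omega : measurableType d) (P : probability Omega R) (E1 E2 : Type)
    (X1 : Omega -> E1) (X2 : Omega -> E2) : Prop :=
  forall (A1 : set E1) (A2 : set E2),
    P (X1 @^-1` A1 `&` X2 @^-1` A2) = (P (X1 @^-1` A1) * P (X2 @^-1` A2))%E.

Definition uniformly_distributed (R : realType) (d : measure_display)
    (Omega : measurableType d) (P : probability Omega R) (E : finType)
    (X : Omega -> E) : Prop :=
  forall x : E, P (X @^-1` [set x]) = ((#|E|%:R : R)^-1)%:E.

(* T n is the tree on n vertices, with vertex set 'I_n numbered by order of
   arrival, and v n is the vertex of T n.+1 to which the next vertex is joined.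
   T 0, a relation on the empty type 'I_0, plays no role. *)
Definition uniform_attachment_tree (R : realType) (d : measure_display)
    (Omega : measurableType d) (P : probability Omega R)
    (T : forall n : nat, Omega -> rel 'I_n) : Prop :=
  exists v : forall n : nat, Omega -> 'I_n.+1,
    [/\ (forall n, discrete_measurable (v n)),
        (forall n, uniformly_distributed P (v n)),
        mutually_independent P v,
        (forall w : Omega, T 1 w = fun _ _ => false)
      & (forall (n : nat) (w : Omega), T n.+2 w = attach (T n.+1 w) (v n w))].

(* Main.v *)
Require Import Defs.
From HB Require Import structures.
From mathcomp Require Import all_boot all_order all_algebra.
From mathcomp Require Import all_classical all_reals all_analysis.
From mathcomp Require Import lra zify.

(** Cut a uniform attachment tree along the edge to the oldest child of its root.
    Given the sizes, the two sides are independent uniform attachment trees, and the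
    size of one of them is uniform ([rrt_split]).  Cutting off the two oldest children
    leaves three pieces: the rest, with the root, and two subtrees hanging below the
    root.  Given two trees, match the rests with each other, and match the subtrees of
    the children in one of the two possible ways; common subtrees of the three matched
    pairs, all containing the roots, are glued at the roots to a common subtree of the
    two trees ([best_match_join], [best_match_swap]).

    If the common subtrees of trees with [x] and [y] vertices had order
    [(x y) ^ s], the gluing would be consistent when the sum over the three classes
    of pieces of [(E X ^ s) ^ 2] is one, [X] being the fraction of the tree taken by
    the piece.  Matching the children by age gives [2 / (1 + s) ^ 2], hence the
    exponent [2 s = 2 (sqrt 2 - 1)], a little less than 0.83.  It is better to
    match a subtree known to be big with another one known to be big: call the oldest
    child the big one if its subtree has at least half of the vertices, and the second
    child otherwise.  At [s = 5 / 12] the sum then exceeds one ([moments_gt1]), so that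
    the exponent [5 / 6 > 0.83] is reached with room to spare.

    To make this rigorous, mark each vertex of the best matching with a small
    probability and bound from below, by induction on the sizes, the probability that
    some mark is left by a multiple of [(x y) ^ s] times a tent function of
    [ln x - ln y] ([pgf_weight]).  The logarithm of the ratio of matched sizes performs
    a symmetric random walk, and the tent is almost subharmonic for it ([tent_sum]);
    the surplus in the moments pays for the difference and for the rounding of the
    sizes to finitely many cells.  This gives matchings of order [n ^ (5 / 6)] with a
    probability bounded away from zero ([rarely_below_lt1]).

    The subtrees of the root's oldest child and the rest are two independent attempts,
    so the probability of failure is roughly squared at the price of a constant factor
    in the size; iterating, it can be made arbitrarily small ([rarely_below_all]).  The
    constant factor is absorbed by the difference between [5 / 6] and [0.83]. *)

Set Implicit Arguments.
Unset Strict Implicit.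
Unset Printing Implicit Defensive.

Import Order.TTheory GRing.Theory Num.Theory.
Import numFieldNormedType.Exports.

Local Open Scope classical_set_scope.
Local Open Scope ring_scope.


(** * Rooted trees cut along the edge to the oldest child *)

(** [Join l r] hangs the tree [r] below the root of the tree [l], as the oldest
    child of that root; the root of [l] is therefore the root of the whole.  With
    this encoding a new vertex becomes the youngest child of [x] when the leaf [x]
    is replaced by a [Join] of two leaves, so that uniform attachment is the growth
    of a binary tree by splitting a uniformly chosen leaf. *)
Inductive rtree (A : Type) : Type :=
| Leaf of A
| Join of rtree A & rtree A.

Fixpoint root (A : Type) (t : rtree A) : A :=
  match t with Leaf x => x | Join l _ => root l end.

Fixpoint vertices (A : Type) (t : rtree A) : seq A :=
  match t with Leaf x => [:: x] | Join l r => vertices l ++ vertices r end.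

Fixpoint edge (A : eqType) (t : rtree A) : rel A :=
  match t with
  | Leaf _ => fun _ _ => false
  | Join l r => fun x y =>
      [|| edge l x y, edge r x y, (x == root l) && (y == root r)
        | (x == root r) && (y == root l)]
  end.

Fixpoint shape (A : Type) (t : rtree A) : rtree unit :=
  match t with Leaf _ => Leaf tt | Join l r => Join (shape l) (shape r) end.

Definition order (A : Type) (t : rtree A) : nat := size (vertices t).

Lemma order_gt0 (A : Type) (t : rtree A) : (0 < order t)%N.
Proof.
rewrite /order; elim: t => [//|l IHl r _] /=.
by rewrite size_cat addn_gt0 IHl.
Qed.

Lemma orderJ (A : Type) (l r : rtree A) :
  order (Join l r) = (order l + order r)%N.
Proof. exact: size_cat. Qed.

Lemma root_vertices (A : eqType) (t : rtree A) : root t \in vertices t.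
Proof.
elim: t => [x|l IHl r _] /=; first exact: mem_head.
by rewrite mem_cat IHl.
Qed.

Lemma edge_sym (A : eqType) (t : rtree A) : symmetric (edge t).
Proof.
elim: t => [//|l IHl r IHr] x y /=.
by rewrite IHl IHr; do 2 congr (_ || _); rewrite orbC; congr (_ || _); rewrite andbC.
Qed.

Lemma edge_vertices (A : eqType) (t : rtree A) (x y : A) :
  edge t x y -> x \in vertices t /\ y \in vertices t.
Proof.
elim: t => [//|l IHl r IHr] /=; rewrite !mem_cat.
case/or4P => [/IHl[-> ->]//|/IHr[-> ->]|/andP[/eqP-> /eqP->]|/andP[/eqP-> /eqP->]].
- by rewrite !orbT.
- by rewrite !root_vertices orbT.
- by rewrite !root_vertices orbT.
Qed.

Lemma index_root (A : eqType) (t : rtree A) : index (root t) (vertices t) = 0%N.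
Proof.
elim: t => [x|l IHl r _] /=; first by rewrite eqxx.
by rewrite index_cat root_vertices.
Qed.

Lemma edge_irr (A : eqType) (t : rtree A) :
  uniq (vertices t) -> irreflexive (edge t).
Proof.
elim: t => [//|l IHl r IHr] /=; rewrite cat_uniq => /and3P[ul dlr ur] x.
rewrite IHl// IHr//=.
suff rlr : root l != root r.
  apply/negbTE/norP; split; apply/negP => /andP[/eqP-> /eqP]; move/eqP.
  - exact/negP.
  - by rewrite eq_sym; exact/negP.
apply: contra dlr => /eqP rlr; apply/hasP; exists (root r).
  exact: root_vertices.
by rewrite /= -rlr root_vertices.
Qed.

(** In preorder every vertex but the root has exactly one neighbour that comes
    before it, its parent; this is what makes cycles impossible. *)
Lemma edge_index_uniq (A : eqType) (t : rtree A) (x y z : A) :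
  uniq (vertices t) -> edge t x y -> edge t x z ->
  (index y (vertices t) < index x (vertices t))%N ->
  (index z (vertices t) < index x (vertices t))%N -> y = z.
Proof.
elim: t => [//|l IHl r IHr] /=; rewrite cat_uniq => /and3P[ul dlr ur].
have disj u : u \in vertices r -> u \in vertices l = false.
  by move=> ur'; apply: contraNF dlr => ul'; apply/hasP; exists u.
have [rl rr] := (root_vertices l, root_vertices r).
rewrite !index_cat.
have nbr w : edge l x w || edge r x w || (x == root l) && (w == root r)
    || (x == root r) && (w == root l) ->
  ((if w \in vertices l then index w (vertices l)
    else size (vertices l) + index w (vertices r)) <
   (if x \in vertices l then index x (vertices l)
    else size (vertices l) + index x (vertices r)))%N ->
  [\/ [/\ x \in vertices l, w \in vertices l, edge l x w &
         (index w (vertices l) < index x (vertices l))%N],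
      [/\ x \in vertices r, w \in vertices r, edge r x w &
         (index w (vertices r) < index x (vertices r))%N]
    | x = root r /\ w = root l].
  case/orP => [/orP[/orP[e|e]|/andP[/eqP-> /eqP->]]|/andP[/eqP-> /eqP->]].
  - by have [xl wl] := edge_vertices e; rewrite xl wl => ?; exact: Or31.
  - have [xr wr] := edge_vertices e; rewrite !disj// ltn_add2l => ?.
    exact: Or32.
  - by rewrite rl disj// !index_root ltn0.
  - move=> _; exact: Or33.
rewrite !orbA => ey ez iy iz.
case: (nbr y ey iy) => [[xl yl eyl iyl]|[xr yr eyr iyr]|[xr ->]];
  case: (nbr z ez iz) => [[xl' zl ezl izl]|[xr' zr ezr izr]|[xr' ->]] //.
- exact: IHl.
- by rewrite disj in xl.
- by rewrite xr' disj in xl.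
- by rewrite disj in xl'.
- exact: IHr.
- by rewrite xr' index_root in iyr.
- by rewrite xr disj in xl'.
- by rewrite xr index_root in izr.
Qed.

(** On a cycle of length at least three, the vertex of largest rank would have
    two neighbours of smaller rank. *)
Lemma acyclic_rank (V : finType) (e : rel V) (rk : V -> nat) :
  symmetric e -> irreflexive e -> injective rk ->
  (forall x y z, e x y -> e x z -> (rk y < rk x)%N -> (rk z < rk x)%N -> y = z) ->
  acyclic e.
Proof.
move=> esym eirr rkI par c /andP[cyc un]; rewrite ltnNge; apply/negP => c3.
have [x0 x0c] : exists x0, x0 \in c by case: c c3 {cyc un} => // x0 c; exists x0; exact: mem_head.
pose x := [arg max_(x > x0 | x \in c) rk x]%N.
have [xc xmax] : x \in c /\ forall y, y \in c -> (rk y <= rk x)%N.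
  by rewrite /x; case: arg_maxnP.
have [i c' rotc] := rot_to xc.
move: cyc un c3; rewrite -(rot_cycle i) -(rot_uniq i) -(size_rot i) rotc.
case: c' rotc => [//|y [//|z c']] rotc cyc un _.
have cmem u : u \in [:: x, y, z & c'] -> (rk u <= rk x)%N.
  by rewrite -rotc mem_rot; exact: xmax.
have lt_rk u : e x u -> u \in [:: x, y, z & c'] -> (rk u < rk x)%N.
  move=> exu uc; rewrite ltn_neqAle cmem// andbT.
  by apply/eqP => /rkI ux; rewrite ux eirr in exu.
move: cyc; rewrite /= rcons_path => /and4P[exy _ _ elast].
have exl : e x (last z c') by rewrite esym.
have lin : last z c' \in z :: c' by exact: mem_last.
have yl : y = last z c'.
  apply: (par x) => //; apply: lt_rk => //.
    by rewrite !inE eqxx orbT.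
  by rewrite in_cons in_cons lin !orbT.
by move: un; rewrite /= yl lin andbF.
Qed.

(** Stated for an arbitrary target graph, so that it applies to the edges carried
    over to a finite type of vertices. *)
Lemma connect_root (A : eqType) (t : rtree A) (V : finType) (g : A -> V)
    (e : rel V) :
  symmetric e -> (forall x y, edge t x y -> e (g x) (g y)) ->
  forall x, x \in vertices t -> connect e (g (root t)) (g x).
Proof.
move=> esym; elim: t => [a|l IHl r IHr] /= ge x.
  by rewrite inE => /eqP->.
rewrite mem_cat => /orP[xl|xr].
  by apply: IHl => // u v uv; apply: ge; rewrite uv.
apply: (@connect_trans _ _ (g (root r))).
  by apply/connect1/ge; rewrite !eqxx !orbT.
by apply: IHr => // u v uv; apply: ge; rewrite uv orbT.
Qed.

Definition vertex_edge (A : choiceType) (t : rtree A) :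
  rel (seq_sub (vertices t)) := fun x y => edge t (val x) (val y).

Lemma vertex_edge_tree (A : choiceType) (t : rtree A) :
  uniq (vertices t) -> is_tree (@vertex_edge A t).
Proof.
move=> un.
have sy : symmetric (@vertex_edge A t) by move=> x y; exact: edge_sym.
have ir : irreflexive (@vertex_edge A t) by move=> x; exact: edge_irr.
split=> //.
- by rewrite card_seq_sub// order_gt0.
- move=> x y.
  pose r0 := SeqSub (root_vertices t).
  pose g a := insubd r0 a.
  have gK a : a \in vertices t -> val (g a) = a by move=> ?; rewrite insubdK.
  have rt z : connect (@vertex_edge A t) r0 z.
    have -> : z = g (val z) by rewrite /g valKd.
    have -> : r0 = g (root t) by apply: val_inj; rewrite gK// root_vertices.
    apply: connect_root => //; last exact: valP.
    move=> a b ab; have [av bv] := edge_vertices ab.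
    by rewrite /vertex_edge !gK.
  by apply: connect_trans (rt y); rewrite sym_connect_sym.
- apply: (@acyclic_rank _ _ (fun x => index (val x) (vertices t))) => //.
    move=> x y xy; apply: val_inj; have := congr1 (nth (val x) (vertices t)) xy.
    by rewrite !nth_index //; exact: valP.
  move=> x y z exy exz yx zx; apply: val_inj.
  exact: (edge_index_uniq un exy exz).
Qed.

(** * Common subtrees of two decomposed trees *)

Lemma has_subtree_copyP (U V : finType) (s : rel U) (e : rel V) (f : U -> V) :
  is_tree s -> injective f -> (forall x y, s x y -> e (f x) (f y)) ->
  has_subtree_copy s e.
Proof.
move=> [ssym sirr U0 scon _] fI se.
pose W := [set f x | x : U]%SET.
pose F : rel V := fun u v => [exists x, exists y, [&& f x == u, f y == v & s x y]].
have FP u v : reflect (exists x y, [/\ f x = u, f y = v & s x y]) (F u v).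
  apply: (iffP existsP) => [[x /existsP[y /and3P[/eqP ? /eqP ? ?]]]|].
    by exists x, y.
  by move=> [x [y [<- <- sxy]]]; exists x; apply/existsP; exists y; rewrite !eqxx.
have Ff x y : F (f x) (f y) = s x y.
  by apply/FP/idP => [[x' [y' [/fI-> /fI->]]]//|?]; exists x, y.
have FW x : f x \in W by exact: imset_f.
exists W, F; split; last first.
  exists f; split => // u; apply/imsetP/codomP => -[x]; first by exists x.
  by exists x.
split.
- by move=> u v; apply/FP/FP => -[x [y [? ? sxy]]]; exists y, x; rewrite ssym.
- by move=> u v /FP[x [y [<- <- sxy]]]; exact: se.
- by move=> u v /FP[x [y [<- <- _]]].
- by case/card_gt0P: U0 => x _; apply/card_gt0P; exists (f x).
- move=> _ _ /imsetP[x _ ->] /imsetP[y _ ->].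
  have /connectP[p + ->] := scon x y.
  elim: p x => [x _|z p IH x /= /andP[sxz zp]]; first exact: connect0.
  by apply: connect_trans (IH z zp); apply: connect1; rewrite Ff.
Qed.

Lemma largest_common_subtree_ge (U V1 V2 : finType) (s : rel U) (e1 : rel V1)
    (e2 : rel V2) :
  is_common_subtree s e1 e2 -> (#|U| <= largest_common_subtree e1 e2)%N.
Proof.
move=> com; have [_ [W [F [_ [f [fI _ _]]]]] _] := com.
have leU : (#|U| < #|V1|.+1)%N by rewrite ltnS; exact: leq_card fI.
rewrite /largest_common_subtree.
apply: (@leq_bigmax_cond _ _ _ (Ordinal leU)).
by apply/asboolP; exists U, s.
Qed.

(** All matchings considered take root to root.  Without the last rule they would
    also have to respect the order of age among the children of a vertex; that rule
    lets the two oldest children of a root exchange their partners, which is what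
    lifts the exponent above [2 (sqrt 2 - 1)], about 0.828.  Every pair of trees
    has the matching of the roots alone. *)
Inductive common : rtree unit -> rtree unit -> nat -> Prop :=
| common1 t t' : common t t' 1%N
| common_join l r l' r' i j :
    common l l' i -> common r r' j -> common (Join l r) (Join l' r') (i + j)%N
| common_swap t r1 r2 t' r1' r2' i j k :
    common t t' i -> common r1 r2' j -> common r2 r1' k ->
    common (Join (Join t r2) r1) (Join (Join t' r2') r1') (i + j + k)%N.

(** A matching is itself a tree, whose vertices are pairs of matched vertices: its
    two projections are the copies of one common subtree. *)
Definition matching (A B : eqType) (t : rtree A) (t' : rtree B)
    (s : rtree (A * B)) : Prop :=
  [/\ root s = (root t, root t'),
      uniq (map fst (vertices s)) /\ uniq (map snd (vertices s)),
      {in vertices s, forall x, x.1 \in vertices t /\ x.2 \in vertices t'}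
    & forall x y, edge s x y -> edge t x.1 y.1 /\ edge t' x.2 y.2].

Lemma matching_leaf (A B : eqType) (t : rtree A) (t' : rtree B) :
  matching t t' (Leaf (root t, root t')).
Proof. by split=> //= x; rewrite inE => /eqP->; rewrite !root_vertices. Qed.

Lemma uniq_join (A : eqType) (l r : rtree A) :
  uniq (vertices (Join l r)) ->
  [/\ uniq (vertices l), uniq (vertices r)
    & {in vertices l & vertices r, forall x y, x != y}].
Proof.
rewrite /= cat_uniq => /and3P[-> /hasPn lr ->]; split=> // x y xl /lr yl.
by apply: contraNneq yl => <-.
Qed.

(** The pairs [l], [l'] and [r], [r'] are not required to exhaust [t] and [t'],
    nor to be cut off by the outermost [Join]: the swapping rule hangs below the
    root a child that is not the oldest one. *)
Lemma matching_join (A B : eqType) (l r t : rtree A) (l' r' t' : rtree B) s1 s2 :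
  {in vertices l & vertices r, forall x y, x != y} ->
  {in vertices l' & vertices r', forall x y, x != y} ->
  {subset vertices l <= vertices t} -> {subset vertices r <= vertices t} ->
  {subset vertices l' <= vertices t'} -> {subset vertices r' <= vertices t'} ->
  subrel (edge l) (edge t) -> subrel (edge r) (edge t) ->
  subrel (edge l') (edge t') -> subrel (edge r') (edge t') ->
  root l = root t -> root l' = root t' ->
  edge t (root t) (root r) -> edge t' (root t') (root r') ->
  matching l l' s1 -> matching r r' s2 -> matching t t' (Join s1 s2).
Proof.
move=> dA dB lt rt lt' rt' el er el' er' rl rl' e e'.
move=> [rs1 [u1 u1'] v1 e1] [rs2 [u2 u2'] v2 e2].
split=> /=.
- by rewrite rs1 rl rl'.
- rewrite !map_cat !cat_uniq u1 u2 u1' u2' /= !andbT; split.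
    apply/hasPn => _ /mapP[y /v2[y2 _] ->]; apply/mapP => -[x /v1[x1 _]] xy.
    by have := dA _ _ x1 y2; rewrite xy eqxx.
  apply/hasPn => _ /mapP[y /v2[_ y2] ->]; apply/mapP => -[x /v1[_ x1]] xy.
  by have := dB _ _ x1 y2; rewrite xy eqxx.
- move=> x; rewrite mem_cat => /orP[/v1[/lt-> /lt'->]//|/v2[/rt-> /rt'->]//].
- move=> x y; rewrite rs1 rs2.
  case/or4P => [/e1[/el-> /el'->]//|/e2[/er-> /er'->]//||].
    by move=> /andP[/eqP-> /eqP->] /=; rewrite rl rl'.
  by move=> /andP[/eqP-> /eqP->] /=; rewrite rl rl' (edge_sym t) (edge_sym t').
Qed.

Lemma common_matching (A B : eqType) (t : rtree A) (t' : rtree B) (k : nat) :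
  uniq (vertices t) -> uniq (vertices t') -> common (shape t) (shape t') k ->
  exists2 s, matching t t' s & order s = k.
Proof.
move=> + + com; move Et : (shape t) com => u com; move Et' : (shape t') com => u' com.
elim: com t t' Et Et' => {u u' k}
  [u u'|ul ur ul' ur' i j _ IHl _ IHr|u u1 u2 u' u1' u2' i j k _ IH0 _ IH1 _ IH2].
- by move=> t t' _ _ _ _; exists (Leaf (root t, root t')) => //; exact: matching_leaf.
- case=> [//|l r] [//|l' r'] [El Er] [El' Er'] /uniq_join[ul0 ur0 d0] /uniq_join[ul1 ur1 d1].
  have [s1 m1 <-] := IHl _ _ El El' ul0 ul1.
  have [s2 m2 <-] := IHr _ _ Er Er' ur0 ur1.
  exists (Join s1 s2); last exact: orderJ.
  by apply: (@matching_join _ _ l r _ l' r') => //=;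
    do ?[by move=> x; rewrite mem_cat => ->; rewrite ?orbT
    | by move=> x y /= ->; rewrite ?orbT | by rewrite !eqxx !orbT].
- case=> [//|[//|l r2] r1] [//|[//|l' r2'] r1'] [El Er2 Er1] [El' Er2' Er1'].
  move=> /uniq_join[/uniq_join[ul0 u20 d0] u10 d10] /uniq_join[/uniq_join[ul1 u21 d1] u11 d11].
  have [s0 m0 <-] := IH0 _ _ El El' ul0 ul1.
  have [s1 m1 <-] := IH1 _ _ Er1 Er2' u10 u21.
  have [s2 m2 <-] := IH2 _ _ Er2 Er1' u20 u11.
  exists (Join (Join s0 s1) s2); last by rewrite !orderJ.
  have sub1 : matching (Join l r1) (Join l' r2') (Join s0 s1).
    apply: (@matching_join _ _ l r1 _ l' r2') => //=;
      do ?[by move=> x; rewrite mem_cat => ->; rewrite ?orbT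
      | by move=> x y /= ->; rewrite ?orbT | by rewrite !eqxx !orbT].
    + by move=> x y xl; apply: d10; rewrite /= mem_cat xl.
  apply: (@matching_join _ _ (Join l r1) r2 _ (Join l' r2') r1') => //=.
  + move=> x y; rewrite mem_cat => /orP[xl|xr1] y2; first exact: d0.
    by rewrite eq_sym; apply: d10 => //=; rewrite mem_cat y2 orbT.
  + by move=> x; rewrite !mem_cat => /orP[]->; rewrite ?orbT.
  + by move=> x; rewrite !mem_cat => ->; rewrite ?orbT.
  + by move=> x; rewrite !mem_cat => ->; rewrite ?orbT.
  + by move=> x; rewrite !mem_cat => ->; rewrite ?orbT.
  + by move=> x y /or4P[]->; rewrite ?orbT.
  + by move=> x y ->; rewrite ?orbT.
  + by move=> x y ->.
  + by move=> x y ->; rewrite ?orbT.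
  + by rewrite !eqxx !orbT.
  + by rewrite !eqxx !orbT.
Qed.

Lemma common_le_lcs (A B : choiceType) (V1 V2 : finType) (t : rtree A)
    (t' : rtree B) (f : A -> V1) (g : B -> V2) (e1 : rel V1) (e2 : rel V2)
    (k : nat) :
  uniq (vertices t) -> uniq (vertices t') ->
  {in vertices t &, injective f} -> {in vertices t' &, injective g} ->
  (forall x y, edge t x y -> e1 (f x) (f y)) ->
  (forall x y, edge t' x y -> e2 (g x) (g y)) ->
  common (shape t) (shape t') k -> (k <= largest_common_subtree e1 e2)%N.
Proof.
move=> ut ut' fI gI fe ge /common_matching[//|//|s [_ [us1 us2] sv se] <-].
have us : uniq (vertices s) by exact: map_uniq us1.
have -> : order s = #|{: seq_sub (vertices s)}| by rewrite card_seq_sub.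
apply: (@largest_common_subtree_ge _ _ _ (@vertex_edge _ s)).
have inj1 (C : eqType) (h : A * B -> C) : uniq (map h (vertices s)) ->
    forall x y : seq_sub (vertices s), h (val x) = h (val y) -> x = y.
  move=> uh x y hxy; apply: val_inj.
  have [xs ys] := (valP x, valP y).
  rewrite -(nth_index (val x) xs) -(nth_index (val x) ys); congr nth.
  apply: (uniqP (h (val x)) uh); rewrite ?inE ?size_map ?index_mem//.
  by rewrite !(nth_map (val x)) ?index_mem// !nth_index.
split; first exact: vertex_edge_tree.
- apply: (@has_subtree_copyP _ _ _ _ (fun x => f (val x).1)).
  + exact: vertex_edge_tree.
  + move=> x y /fI xy; apply: (inj1 _ fst) => //; apply: xy.
      by have [] := sv _ (valP x).
    by have [] := sv _ (valP y).
  + by move=> x y /se[/fe].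
- apply: (@has_subtree_copyP _ _ _ _ (fun x => g (val x).2)).
  + exact: vertex_edge_tree.
  + move=> x y /gI xy; apply: (inj1 _ snd) => //; apply: xy.
      by have [] := sv _ (valP x).
    by have [] := sv _ (valP y).
  + by move=> x y /se[_ /ge].
Qed.

Lemma common_le_order (t t' : rtree unit) (k : nat) :
  common t t' k -> (k <= order t)%N.
Proof.
elim=> {t t' k} [t t'|l r l' r' i j _ il _ jr|t r1 r2 t' r1' r2' i j k _ ? _ ? _ ?].
- exact: order_gt0.
- by rewrite orderJ leq_add.
- by rewrite !orderJ -addnA (addnC j) addnA !leq_add.
Qed.

Definition best_match (t t' : rtree unit) : nat :=
  \max_(k < (order t).+1 | `[< common t t' k >]) k.

Lemma best_match_ge (t t' : rtree unit) (k : nat) : common t t' k -> (k <= best_match t t')%N.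
Proof.
move=> com; have kt : (k < (order t).+1)%N by rewrite ltnS; exact: common_le_order com.
by apply: (@leq_bigmax_cond _ _ _ (Ordinal kt)); exact/asboolP.
Qed.

Lemma best_match_gt0 (t t' : rtree unit) : (0 < best_match t t')%N.
Proof. by apply: best_match_ge; exact: common1. Qed.

Lemma best_matchP (t t' : rtree unit) : common t t' (best_match t t').
Proof.
have h1 : (1 < (order t).+1)%N by rewrite ltnS order_gt0.
have [|i /asboolP + E] := @eq_bigmax_cond _
  [pred k : 'I_(order t).+1 | `[< common t t' k >]] (@nat_of_ord _).
  by apply/card_gt0P; exists (Ordinal h1); apply/asboolP; exact: common1.
by rewrite -E.
Qed.

Lemma best_match_join (l r l' r' : rtree unit) :
  (best_match l l' + best_match r r' <= best_match (Join l r) (Join l' r'))%N.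
Proof. by apply/best_match_ge/common_join; exact: best_matchP. Qed.

Lemma best_match_swap (t r1 r2 t' r1' r2' : rtree unit) :
  (best_match t t' + best_match r1 r2' + best_match r2 r1' <=
   best_match (Join (Join t r2) r1) (Join (Join t' r2') r1'))%N.
Proof. by apply/best_match_ge/common_swap; exact: best_matchP. Qed.

(** * Growth by uniform attachment and its splitting law *)

Fixpoint grow (A : eqType) (v u : A) (t : rtree A) : rtree A :=
  match t with
  | Leaf x => if x == v then Join (Leaf x) (Leaf u) else Leaf x
  | Join l r => Join (grow v u l) (grow v u r)
  end.

Lemma grow_notin (A : eqType) (v u : A) (t : rtree A) :
  v \notin vertices t -> grow v u t = t.
Proof.
elim: t => [x|l IHl r IHr] /=; first by rewrite inE eq_sym => /negbTE->.
by rewrite mem_cat => /norP[/IHl-> /IHr->].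
Qed.

Lemma root_grow (A : eqType) (v u : A) (t : rtree A) : root (grow v u t) = root t.
Proof. by elim: t => [x|l IHl r _] //=; case: eqP. Qed.

Lemma vertices_grow (A : eqType) (v u : A) (t : rtree A) :
  uniq (vertices t) -> v \in vertices t ->
  perm_eq (vertices (grow v u t)) (u :: vertices t).
Proof.
elim: t => [x|l IHl r IHr] /=.
  by rewrite inE => _ /eqP->; rewrite eqxx; apply/permP => p /=; rewrite !addn0 addnC.
rewrite cat_uniq => /and3P[ul lr ur]; rewrite mem_cat => /orP[vl|vr].
  rewrite (@grow_notin _ v u r).
    by rewrite -cat_cons perm_cat2r IHl.
  by apply: contra lr => vr; apply/hasP; exists v.
rewrite (@grow_notin _ v u l); last by apply: contra lr => vl; apply/hasP; exists v.
rewrite perm_sym -cat1s perm_catCA perm_cat2l perm_sym; exact: IHr.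
Qed.

Lemma edge_grow (A : eqType) (v u : A) (t : rtree A) :
  uniq (vertices t) -> v \in vertices t ->
  edge (grow v u t) =2
  fun x y => [|| edge t x y, (x == v) && (y == u) | (x == u) && (y == v)].
Proof.
elim: t => [a|l IHl r IHr] /=.
  by rewrite inE => _ /eqP-> x y; rewrite eqxx.
rewrite cat_uniq => /and3P[ul lr ur]; rewrite mem_cat => /orP[vl|vr] x y.
  rewrite (@grow_notin _ v u r); last by apply: contra lr => vr; apply/hasP; exists v.
  rewrite root_grow IHl//.
  by case: (edge l x y) => //=; rewrite orbC.
rewrite (@grow_notin _ v u l); last by apply: contra lr => vl; apply/hasP; exists v.
rewrite root_grow IHr//; case: (edge l x y) => //=; case: (edge r x y) => //=.
exact: orbC.
Qed.

Fixpoint growths (s : rtree unit) : seq (rtree unit) :=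
  match s with
  | Leaf _ => [:: Join (Leaf tt) (Leaf tt)]
  | Join l r => [seq Join l' r | l' <- growths l] ++ [seq Join l r' | r' <- growths r]
  end.

Lemma size_growths (s : rtree unit) : size (growths s) = order s.
Proof.
by elim: s => [//|l IHl r IHr] /=; rewrite size_cat !size_map IHl IHr orderJ.
Qed.

HB.instance Definition _ (A : Type) := gen_eqMixin (rtree A).

Lemma growths_order (s s' : rtree unit) :
  s' \in growths s -> order s' = (order s).+1.
Proof.
elim: s s' => [[] s'|l IHl r IHr s'] /=; first by rewrite inE => /eqP->.
rewrite mem_cat => /orP[] /mapP[u ug ->]; rewrite !orderJ.
  by rewrite (IHl _ ug) addSn.
by rewrite (IHr _ ug) addnS.
Qed.

Lemma shape_grow (A : eqType) (u : A) (t : rtree A) :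
  uniq (vertices t) ->
  [seq shape (grow v u t) | v <- vertices t] = growths (shape t).
Proof.
elim: t => [x _|l IHl r IHr] /=; first by rewrite eqxx.
rewrite cat_uniq => /and3P[ul lr ur]; rewrite map_cat -IHl// -IHr// -!map_comp.
congr cat; apply/eq_in_map => v vt /=.
  rewrite (@grow_notin _ v u r)//.
  by apply: contra lr => vr; apply/hasP; exists v.
rewrite (@grow_notin _ v u l)//.
by apply: contra lr => vl; apply/hasP; exists v.
Qed.

Lemma order_shape (A : Type) (t : rtree A) : order (shape t) = order t.
Proof. by elim: t => [//|l IHl r IHr] /=; rewrite !orderJ IHl IHr. Qed.

Section Mean.
Variable R : realType.
Implicit Types (F : rtree unit -> R) (s : rtree unit).

(** The expectation of [F] after [k] steps of growth from [s], by recursion on the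
    first step; [mean_last] is the recursion on the last one. *)
Fixpoint mean (k : nat) F s : R :=
  if k is k'.+1 then
    (size (growths s))%:R^-1 * \sum_(s' <- growths s) mean k' F s'
  else F s.

Definition avg F s : R := (size (growths s))%:R^-1 * \sum_(s' <- growths s) F s'.

Lemma growths_gt0 s : 0 < (size (growths s))%:R :> R.
Proof. by rewrite ltr0n size_growths order_gt0. Qed.

Lemma meanS (k : nat) F s : mean k.+1 F s = avg (mean k F) s.
Proof. by []. Qed.

Lemma mean_last (k : nat) F s : mean k.+1 F s = mean k (avg F) s.
Proof.
elim: k s => [//|k IH] s; rewrite meanS meanS; congr (_ * _).
by apply: eq_bigr => s' _.
Qed.

Lemma mean_le (k : nat) F F' s : (forall s, F s <= F' s) -> mean k F s <= mean k F' s.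
Proof.
move=> FF'; elim: k s => [//|k IH] s /=.
by rewrite ler_pM2l ?invr_gt0 ?growths_gt0// ler_sum.
Qed.

Lemma mean_ext_order (k : nat) F F' s :
  (forall s', order s' = (order s + k)%N -> F s' = F' s') -> mean k F s = mean k F' s.
Proof.
elim: k s => [|k IH] s FF' /=; first by apply: FF'; rewrite addn0.
congr (_ * _); apply: eq_big_seq => s' /growths_order s's; apply: IH => s''.
by rewrite s's addSnnS; exact: FF'.
Qed.

Lemma mean_ext (k : nat) F F' s : (forall s, F s = F' s) -> mean k F s = mean k F' s.
Proof. by move=> FF'; apply: mean_ext_order. Qed.

Lemma meanD (k : nat) F F' s : mean k (fun s => F s + F' s) s = mean k F s + mean k F' s.
Proof.
elim: k s => [//|k IH] s /=.
by rewrite -mulrDr -big_split; congr (_ * _); apply: eq_bigr => ? _; rewrite IH.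
Qed.

Lemma meanZ (k : nat) (a : R) F s : mean k (fun s => a * F s) s = a * mean k F s.
Proof.
elim: k s => [//|k IH] s /=.
rewrite mulrCA; congr (_ * _); rewrite mulr_sumr.
by apply: eq_bigr => ? _; rewrite IH.
Qed.

Lemma mean_cst (k : nat) (a : R) s : mean k (fun=> a) s = a.
Proof.
elim: k s => [//|k IH] s /=.
rewrite (eq_bigr (fun=> a)) => [|? _]; last exact: IH.
rewrite big_const_seq count_predT iter_addr_0 -[X in _ * X]mulr_natl mulrA mulVf ?mul1r//.
by rewrite gt_eqF// growths_gt0.
Qed.

Lemma mean_sum (I : Type) (r : seq I) (P : pred I) (k : nat) (F : I -> rtree unit -> R) s :
  mean k (fun s => \sum_(i <- r | P i) F i s) s = \sum_(i <- r | P i) mean k (F i) s.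
Proof.
elim: r => [|i r IH].
  by rewrite big_nil -[RHS](mean_cst k _ s); apply: mean_ext => s'; rewrite big_nil.
rewrite big_cons -IH; case: ifP => Pi.
  by rewrite -meanD; apply: mean_ext => s'; rewrite big_cons Pi.
by apply: mean_ext => s'; rewrite big_cons Pi.
Qed.

(** The tree obtained after [k] steps has [k.+1] vertices. *)
Definition rrt (k : nat) F : R := mean k F (Leaf tt).

(** Polya's urn: a new vertex falls on either side of the edge to the oldest child
    with probability proportional to the size of that side, which keeps the size of
    a side uniform on [1, k.+1], and within the side it is attached uniformly. *)
Lemma rrt_split (k : nat) F :
  rrt k.+1 F = k.+1%:R^-1 *
    \sum_(i < k.+1) rrt i (fun l => rrt (k - i) (fun r => F (Join l r))).
Proof.
elim: k F => [|k IH] F.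
  by rewrite /rrt /= !big_seq1 big_ord_recl big_ord0 addr0 /= !invr1 !mul1r.
rewrite {1}/rrt mean_last -/(rrt _ _) IH.
have avgJ (i : 'I_k.+1) :
    rrt i (fun l => rrt (k - i) (fun r => avg F (Join l r))) =
    k.+2%:R^-1 * (i.+1%:R * rrt i.+1 (fun l => rrt (k - i) (fun r => F (Join l r)))
      + (k - i).+1%:R * rrt i (fun l => rrt (k - i).+1 (fun r => F (Join l r)))).
  have ik : (i <= k)%N by rewrite -ltnS.
  have eA l r : order l = i.+1 -> order r = (k - i).+1 ->
      avg F (Join l r) = k.+2%:R^-1 *
        (i.+1%:R * avg (fun l => F (Join l r)) l + (k - i).+1%:R * avg (fun r => F (Join l r)) r).
    move=> ol or; rewrite /avg !size_growths orderJ ol or addSn addnS subnKC//.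
    rewrite !mulrA !divff ?pnatr_eq0// !mul1r; congr (_ * _) => /=.
    by rewrite big_cat !big_map.
  transitivity (rrt i (fun l => k.+2%:R^-1 * (i.+1%:R * rrt (k - i)
      (fun r => avg (fun l => F (Join l r)) l) +
      (k - i).+1%:R * rrt (k - i).+1 (fun r => F (Join l r))))).
    apply: mean_ext_order => l ol; rewrite {3}/rrt mean_last /rrt -!meanZ -meanD -meanZ.
    by apply: mean_ext_order => r or; apply: eA.
  rewrite /rrt meanZ meanD !meanZ; congr (_ * (_ * _ + _)).
  rewrite mean_last /avg; apply: mean_ext => l.
  by rewrite meanZ mean_sum.
under eq_bigr => i _ do rewrite avgJ.
rewrite -mulr_sumr mulrCA; congr (_ * _).
rewrite big_split /=.
pose f i := rrt i (fun l => rrt (k.+1 - i) (fun r => F (Join l r))).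
have -> : \sum_(i < k.+1) i.+1%:R * rrt i.+1 (fun l => rrt (k - i) (fun r => F (Join l r)))
    = \sum_(i < k.+2) i%:R * f i.
  by rewrite [RHS]big_ord_recl mul0r add0r; apply: eq_bigr => i _; rewrite /f subSS.
have -> : \sum_(i < k.+1) (k - i).+1%:R * rrt i (fun l => rrt (k - i).+1 (fun r => F (Join l r)))
    = \sum_(i < k.+2) (k.+1 - i)%:R * f i.
  rewrite [RHS]big_ord_recr /= subnn mul0r addr0; apply: eq_bigr => i _.
  by rewrite /f subSn// -ltnS.
rewrite -big_split /=.
rewrite (eq_bigr (fun i : 'I_k.+2 => k.+1%:R * f i)) => [|i _]; last first.
  by rewrite -mulrDl -natrD subnKC// -ltnS.
by rewrite -mulr_sumr mulrA mulVf ?mul1r// pnatr_eq0.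
Qed.
End Mean.

(** * Discretising the split *)

Section Cells.
Variable R : realType.

Lemma mean_exchange (k k' : nat) (D : rtree unit -> rtree unit -> R) s s' :
  mean k (fun t => mean k' (D t) s') s = mean k' (fun t' => mean k (D^~ t') s) s'.
Proof.
elim: k s => [//|k IH] s; rewrite meanS /avg.
under eq_bigr => t _ do rewrite IH.
by rewrite -mean_sum -meanZ.
Qed.

Lemma rrt_exchange (k k' : nat) (D : rtree unit -> rtree unit -> R) :
  rrt k (fun t => rrt k' (D t)) = rrt k' (fun t' => rrt k (D^~ t')).
Proof. exact: mean_exchange. Qed.

Lemma rrt_le (k : nat) (F F' : rtree unit -> R) :
  (forall t, F t <= F' t) -> rrt k F <= rrt k F'.
Proof. exact: mean_le. Qed.

Lemma rrt_ge0 (k : nat) (F : rtree unit -> R) : (forall t, 0 <= F t) -> 0 <= rrt k F.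
Proof. by move=> F0; rewrite -(mean_cst k 0 (Leaf tt)); exact: mean_le. Qed.

Lemma rrt_1sub (k : nat) (c : R) (F : rtree unit -> R) :
  rrt k (fun t => 1 - c * F t) = 1 - c * rrt k F.
Proof.
transitivity (mean k (fun t => 1 + (- c) * F t) (Leaf tt)).
  by apply: mean_ext => t; rewrite mulNr.
by rewrite meanD meanZ mean_cst mulNr.
Qed.

(** The smallest fraction of the vertices that a piece of the [j]-th cell can
    have: the choices for a splitting are cut into [N + 2] equal blocks, of which
    the two extreme ones are discarded, and the third additional unit in the
    denominator absorbs the rounding. *)
Definition frac (N : nat) (j : nat) : R := j.+1%:R / (N + 3)%:R.

Lemma frac_gt0 N j : 0 < frac N j.
Proof. by rewrite divr_gt0// ltr0n addn3. Qed.

Lemma frac_le1 N j : (j <= N)%N -> frac N j <= 1.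
Proof. by move=> jN; rewrite ler_pdivrMr ?ltr0n ?addn3// mul1r ler_nat !ltnS; lia. Qed.

(** Each cell is hit by at least a fraction [1 / (N + 3)] of the [M] choices, and
    the cells are mirror images of each other under exchange of the two sides. *)
Lemma cell_sum (N M : nat) (f b : nat -> R) :
  ((N + 3) ^ 2 <= M)%N ->
  (forall i, 0 <= f i) -> (forall j, 0 <= b j) ->
  (forall (j : 'I_N) i, (i < M)%N -> frac N j * M.+1%:R <= i.+1%:R ->
     frac N (rev_ord j) * M.+1%:R <= (M - i)%:R -> b j <= f i) ->
  (N + 3)%:R^-1 * \sum_(j < N) b j <= M%:R^-1 * \sum_(i < M) f i.
Proof.
move=> NM f0 b0 bf.
set m := (M %/ (N + 2))%N.
have mN : (N + 2 <= m)%N by rewrite leq_divRL//; lia.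
have m1 : (m * (N + 2) <= M)%N by exact: leq_divM.
have m2 : (M < m.+1 * (N + 2))%N by rewrite ltn_ceil//; lia.
have M0 : 0 < M%:R :> R by rewrite ltr0n; lia.
have L0 : 0 < (N + 3)%:R :> R by rewrite ltr0n; lia.
have -> : \sum_(i < M) f i = \sum_(0 <= i < M) f i by rewrite big_mkord.
have block : m%:R * \sum_(j < N) b j <= \sum_(0 <= i < M) f i.
  rewrite (@big_cat_nat _ _ _ (N.+1 * m)) //=; last by lia.
  apply: (@le_trans _ _ (\sum_(0 <= i < N.+1 * m) f i)); last first.
    by rewrite lerDl sumr_ge0.
  rewrite big_nat_mul big_nat_recl// big_mkord -[X in X <= _]add0r.
  apply: lerD; first by rewrite sumr_ge0.
  rewrite mulr_sumr; apply: ler_sum => j _.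
  have -> : m%:R * b j = \sum_(j.+1 * m <= i < j.+2 * m) b j.
    by rewrite big_const_nat iter_addr_0 -[X in _ = X]mulr_natl; congr (_%:R * _); lia.
  apply: ler_sum_nat => i /andP[ji ij].
  have jN := ltn_ord j.
  apply: bf; first by nia.
  - rewrite /frac mulrAC ler_pdivrMr// -!natrM ler_nat; nia.
  - rewrite /frac /= mulrAC ler_pdivrMr// -!natrM ler_nat subnSK//; nia.
rewrite ler_pdivlMl// mulrA; apply: le_trans block.
apply: ler_wpM2r; first exact: sumr_ge0.
by rewrite ler_pdivrMr// -natrM ler_nat; nia.
Qed.

Lemma rrt_cells (N k : nat) (F : rtree unit -> R) (b : nat -> R) :
  ((N + 3) ^ 2 <= k)%N -> (forall t, 0 <= F t) -> (forall j, 0 <= b j) ->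
  (forall (j : 'I_N) i i', (i < k)%N -> (i' < k)%N ->
     frac N j * k.+1%:R <= i.+1%:R -> frac N (rev_ord j) * k.+1%:R <= i'.+1%:R ->
     b j <= rrt i (fun l => rrt i' (fun r => F (Join l r)))) ->
  (N + 3)%:R^-1 * \sum_(j < N) b j <= rrt k F.
Proof.
move=> Nk F0 b0 bF; case: k => [|k] in Nk bF *; first by lia.
rewrite rrt_split.
pose f i : R := rrt i (fun l => rrt (k - i) (fun r => F (Join l r))).
apply: (@cell_sum _ _ f) => //.
  by move=> i; apply: rrt_ge0 => l; exact: rrt_ge0.
move=> j i ik h1 h2; apply: bF => //; first by lia.
by rewrite -subSn.
Qed.

(** The piece that is split a second time must itself be large enough to be cut
    into cells, whence the cubic lower bound on the number of vertices. *)
Lemma rrt_cells2 (N k : nat) (F : rtree unit -> R) (b : nat -> nat -> R) :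
  ((N + 3) ^ 3 + (N + 3) <= k.+1)%N -> (forall t, 0 <= F t) -> (forall j1 j2, 0 <= b j1 j2) ->
  (forall (j1 j2 : 'I_N) i1 i2 i3, (i1 < k)%N -> (i2 < k)%N -> (i3 < k)%N ->
     frac N j1 * frac N j2 * k.+1%:R <= i1.+1%:R ->
     frac N j1 * frac N (rev_ord j2) * k.+1%:R <= i2.+1%:R ->
     frac N (rev_ord j1) * k.+1%:R <= i3.+1%:R ->
     b j1 j2 <= rrt i1 (fun t => rrt i2 (fun r2 => rrt i3 (fun r1 =>
       F (Join (Join t r2) r1))))) ->
  (N + 3)%:R^-2 * \sum_(j1 < N) \sum_(j2 < N) b j1 j2 <= rrt k F.
Proof.
move=> Nk F0 b0 bF.
have L0 : 0 < (N + 3)%:R :> R by rewrite ltr0n; lia.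
rewrite expr2 invfM -mulrA (mulr_sumr _ _ _ (N + 3)%:R^-1).
apply: (@rrt_cells _ _ _ (fun j => (N + 3)%:R^-1 * \sum_(j2 < N) b j j2)) => //.
- by nia.
- by move=> j; rewrite mulr_ge0 ?invr_ge0 ?sumr_ge0// ltW.
move=> j i i' ik i'k h1 h2.
have Li : ((N + 3) ^ 2 <= i)%N.
  have : k.+1%:R <= (i.+1 * (N + 3))%:R :> R.
    rewrite natrM -ler_pdivrMr//; apply: le_trans h1; rewrite mulrC ler_pM2r ?ltr0n//.
    by rewrite /frac ler_peMl ?invr_ge0 ?(ltW L0)// ler1n.
  by rewrite ler_nat; nia.
apply: rrt_cells => //; first by move=> t; exact: rrt_ge0.
move=> j2 i1 i2 i1i i2i h3 h4; apply: bF => //; try lia.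
- by rewrite mulrAC mulrC; apply: le_trans h3; rewrite ler_pM2l ?frac_gt0.
- by rewrite mulrAC mulrC; apply: le_trans h4; rewrite ler_pM2l ?frac_gt0.
Qed.

Lemma rrt_pair_cells2 (N k k' : nat) (D : rtree unit -> rtree unit -> R)
    (b : nat -> nat -> nat -> nat -> R) :
  ((N + 3) ^ 3 + (N + 3) <= k.+1)%N -> ((N + 3) ^ 3 + (N + 3) <= k'.+1)%N ->
  (forall t t', 0 <= D t t') -> (forall j1 j2 j1' j2', 0 <= b j1 j2 j1' j2') ->
  (forall (j1 j2 j1' j2' : 'I_N) i1 i2 i3 i1' i2' i3',
     (i1 < k)%N -> (i2 < k)%N -> (i3 < k)%N ->
     frac N j1 * frac N j2 * k.+1%:R <= i1.+1%:R ->
     frac N j1 * frac N (rev_ord j2) * k.+1%:R <= i2.+1%:R ->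
     frac N (rev_ord j1) * k.+1%:R <= i3.+1%:R ->
     frac N j1' * frac N j2' * k'.+1%:R <= i1'.+1%:R ->
     frac N j1' * frac N (rev_ord j2') * k'.+1%:R <= i2'.+1%:R ->
     frac N (rev_ord j1') * k'.+1%:R <= i3'.+1%:R ->
     b j1 j2 j1' j2' <=
     rrt i1' (fun t' => rrt i2' (fun r2' => rrt i3' (fun r1' =>
       rrt i1 (fun t => rrt i2 (fun r2 => rrt i3 (fun r1 =>
         D (Join (Join t r2) r1) (Join (Join t' r2') r1')))))))) ->
  (N + 3)%:R^-4 * \sum_(j1 < N) \sum_(j2 < N) \sum_(j1' < N) \sum_(j2' < N)
    b j1 j2 j1' j2' <= rrt k (fun t => rrt k' (D t)).
Proof.
move=> Nk Nk' D0 b0 bD.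
have -> : (N + 3)%:R^-4 * \sum_(j1 < N) \sum_(j2 < N) \sum_(j1' < N) \sum_(j2' < N)
    b j1 j2 j1' j2' = (N + 3)%:R^-2 * \sum_(j1 < N) \sum_(j2 < N)
      ((N + 3)%:R^-2 * \sum_(j1' < N) \sum_(j2' < N) b j1 j2 j1' j2') :> R.
  rewrite (exprD _ 2 2) invfM -mulrA; congr (_ * _); rewrite mulr_sumr.
  by apply: eq_bigr => j1 _; rewrite mulr_sumr.
have L0 : 0 <= (N + 3)%:R^-2 :> R by rewrite invr_ge0 exprn_ge0.
apply: (@rrt_cells2 _ _ _ (fun j1 j2 =>
  (N + 3)%:R^-2 * \sum_(j1' < N) \sum_(j2' < N) b j1 j2 j1' j2')) => //.
- by move=> t; exact: rrt_ge0.
- by move=> j1 j2; rewrite mulr_ge0 ?sumr_ge0// => j _; rewrite sumr_ge0.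
move=> j1 j2 i1 i2 i3 l1 l2 l3 h1 h2 h3.
have -> : rrt i1 (fun t => rrt i2 (fun r2 => rrt i3 (fun r1 =>
      rrt k' (D (Join (Join t r2) r1))))) =
    rrt k' (fun t' => rrt i1 (fun t => rrt i2 (fun r2 => rrt i3 (fun r1 =>
      D (Join (Join t r2) r1) t')))).
  rewrite [RHS]rrt_exchange; apply: mean_ext => t.
  rewrite -/(rrt _ _) -/(rrt _ _) [RHS]rrt_exchange; apply: mean_ext => r2.
  by rewrite -/(rrt _ _) -/(rrt _ _) [RHS]rrt_exchange.
apply: rrt_cells2 => //.
- by move=> t'; do 3 apply: rrt_ge0 => ?.
- by move=> *; apply: bD.
Qed.

(** The six pieces are independent, and the integrand is a product of functions of
    one matched pair each. *)
Lemma rrt_prod3 (i1 i2 i3 i1' i2' i3' : nat) (f g h : rtree unit -> rtree unit -> R) :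
  rrt i1' (fun t' => rrt i2' (fun u' => rrt i3' (fun v' =>
    rrt i1 (fun t => rrt i2 (fun u => rrt i3 (fun v =>
      1 - f t t' * g u u' * h v v')))))) =
  1 - rrt i1' (fun t' => rrt i1 (f^~ t')) * rrt i2' (fun t' => rrt i2 (g^~ t')) *
      rrt i3' (fun t' => rrt i3 (h^~ t')).
Proof.
have ext k F F' : (forall s, F s = F' s) -> rrt k F = rrt k F' :> R by exact: mean_ext.
set a' := rrt i1' _; set b' := rrt i2' _; set c' := rrt i3' _.
transitivity (rrt i1' (fun t' => rrt i2' (fun u' => rrt i3' (fun v' =>
   1 - (rrt i1 (f^~ t') * rrt i2 (g^~ u')) * rrt i3 (h^~ v'))))).
  apply: (ext) => t'; apply: (ext) => u'; apply: (ext) => v'.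
  transitivity (rrt i1 (fun t => 1 - (rrt i2 (g^~ u') * rrt i3 (h^~ v')) * f t t')).
    apply: (ext) => t.
    transitivity (rrt i2 (fun u => 1 - (f t t' * rrt i3 (h^~ v')) * g u u')).
      by apply: (ext) => u; rewrite rrt_1sub mulrAC.
    by rewrite rrt_1sub; congr (_ - _); lra.
  by rewrite rrt_1sub; congr (_ - _); lra.
transitivity (rrt i1' (fun t' => 1 - (b' * c') * rrt i1 (f^~ t'))).
  apply: (ext) => t'.
  transitivity (rrt i2' (fun u' => 1 - (rrt i1 (f^~ t') * c') * rrt i2 (g^~ u'))).
    by apply: (ext) => u'; rewrite rrt_1sub -/c' mulrAC.
  by rewrite rrt_1sub -/b'; congr (_ - _); lra.
by rewrite rrt_1sub -/a'; congr (_ - _); lra.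
Qed.
End Cells.

(** * The branching inequality in the limit of large trees *)

Section Analysis.
Variable R : realType.

(** A tent in the logarithm [r] of the ratio of two sizes.  A symmetric random
    increment does not lower the mean of the tent far from its tip, where the tent
    is convex, the kinks at both ends included; near the tip it lowers it by at
    most the size of the increment, which is small compared with the height. *)
Lemma tent_sum (I : finType) (W D : I -> R) (B h r e : R) :
  (forall i, 0 <= W i) -> (forall i j, `|D i - D j| <= B) -> 0 <= e ->
  0 <= B -> `|r| <= h -> B <= e * (h - B) ->
  (1 - e) * (\sum_i W i) ^+ 2 * (h - `|r|) <=
  \sum_i \sum_j W i * W j * Num.max 0 (h - `|r + (D i - D j)|).
Proof.
move=> W0 DB e0 B0 rh Bh.
have W2 : (\sum_i W i) ^+ 2 = \sum_i \sum_j W i * W j.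
  by rewrite expr2 mulr_suml; apply: eq_bigr => i _; rewrite mulr_sumr.
have W20 : 0 <= (\sum_i W i) ^+ 2 by exact: sqr_ge0.
have far (d : R) : (forall i j, `|r + (D i - D j)| = d * (r + (D i - D j))) ->
    d * r = `|r| ->
    (1 - e) * (\sum_i W i) ^+ 2 * (h - `|r|) <=
    \sum_i \sum_j W i * W j * Num.max 0 (h - `|r + (D i - D j)|).
  move=> abs dr.
  apply: (@le_trans _ _ ((\sum_i W i) ^+ 2 * (h - `|r|))).
    by rewrite ler_wpM2r ?subr_ge0// ler_piMl// gerBl.
  have antisym : \sum_i \sum_j W i * W j * (d * (D i - D j)) = 0.
    set S := LHS.
    have : S = - S.
      rewrite /S [RHS](congr1 -%R (exchange_big _ _ _ _ _ _)) -sumrN /=.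
      apply: eq_bigr => i _; rewrite -sumrN; apply: eq_bigr => j _.
      by rewrite (mulrC (W j)); lra.
    lra.
  rewrite -[leLHS]subr0 -[X in _ - X <= _]antisym W2 mulr_suml -sumrB; apply: ler_sum => i _.
  rewrite mulr_suml -sumrB; apply: ler_sum => j _.
  rewrite -mulrBr ler_wpM2l ?mulr_ge0//.
  rewrite le_max abs; apply/orP; right.
  suff -> : h - `|r| - d * (D i - D j) = h - d * (r + (D i - D j)) by [].
  by rewrite -dr; lra.
have DBlr i j : - B <= D i - D j <= B by rewrite -ler_norml.
have [rB|rB] := leP B r.
  apply: (far 1) => [i j|]; last by rewrite mul1r ger0_norm// (le_trans B0).
  by rewrite mul1r ger0_norm//; have := DBlr i j; lra.
have [rNB|rNB] := leP r (- B).
  apply: (far (-1)) => [i j|]; last by rewrite mulN1r ler0_norm//; lra.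
  by rewrite mulN1r ler0_norm//; have := DBlr i j; lra.
have rB' : `|r| <= B by rewrite ler_norml; lra.
rewrite W2 -mulrA mulrCA mulr_suml; apply: ler_sum => i _.
rewrite mulr_suml; apply: ler_sum => j _; rewrite ler_wpM2l ?mulr_ge0//.
rewrite le_max; apply/orP; right.
have : `|r + (D i - D j)| <= `|r| + B by rewrite (le_trans (ler_normD _ _))// lerD2l.
have : e * (h - B) <= e * (h - `|r|) by rewrite ler_wpM2l// lerD2l lerN2.
by rewrite mulrBl mul1r; lra.
Qed.

Local Notation s := (5 / 12 : R).
Local Notation p := (17 / 12 : R).

(** Young's inequality in the guise of convexity: it compares the increment of the
    antiderivative of the power [s] with that power. *)
Lemma powR_subl (a b : R) : 0 <= b -> 0 <= a ->
  12 / 17 * (a `^ p - b `^ p) <= a `^ s * (a - b).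
Proof.
move=> b0 a0.
have := @conjugate_powR R (a `^ s) b (17 / 5) p (powR_ge0 _ _) b0.
rewrite -powRrM; have -> : s * (17 / 5) = p by lra.
have aa : a `^ p = a `^ s * a.
  rewrite -{3}(powRr1 a0) -powRD; last by apply/implyP => /eqP; lra.
  by congr (_ `^ _); lra.
have q1 : (17 / 5 : R)^-1 + p^-1 = 1 by rewrite !invf_div; lra.
move=> /(_ _ _ q1) h; have {h} := h ltac:(lra) ltac:(lra).
by rewrite !invf_div (mulrBr (a `^ s)) -aa; lra.
Qed.

Lemma sum_powR (m n : nat) : (m <= n)%N ->
  12 / 17 * (n%:R `^ p - m%:R `^ p) <= \sum_(m <= j < n) j.+1%:R `^ s :> R.
Proof.
elim: n => [|n IH] mn; first by move: mn; rewrite leqn0 => /eqP->; rewrite subrr mulr0 big_geq.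
move: mn; rewrite leq_eqVlt => /orP[/eqP->|mn]; first by rewrite subrr mulr0 big_geq.
rewrite big_nat_recr//=.
have := IH mn; have := @powR_subl n.+1%:R n%:R (ler0n _ _) (ler0n _ _).
have -> : n.+1%:R - n%:R = 1 :> R by rewrite -natrB// subSnn.
by rewrite mulr1; lra.
Qed.

Section Moments.
Variable K : nat.
Hypothesis K1000 : (1000 <= K)%N.
Local Notation N := (2 * K)%N.
Local Notation L := ((N + 3)%:R : R).

(** An upper Riemann sum for the integral of the power [s] between [a / L] and
    [b / L]. *)
Definition fracS (a b : nat) : R := L^-1 * \sum_(a <= j < b) frac R N j `^ s.

Let L0 : 0 < L. Proof. by rewrite ltr0n addn3. Qed.

Lemma fracS_ge (a b : nat) : (a <= b)%N ->
  12 / 17 * ((b%:R / L) `^ p - (a%:R / L) `^ p) <= fracS a b.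
Proof.
move=> ab; rewrite /fracS.
have -> : \sum_(a <= j < b) frac R N j `^ s = L `^ (- s) * \sum_(a <= j < b) j.+1%:R `^ s.
  rewrite mulr_sumr; apply: eq_bigr => j _.
  rewrite /frac powRM ?ler0n ?invr_ge0 ?(ltW L0)// mulrC powRN.
  by rewrite -powR_inv1 ?(ltW L0)// -powRrM mulN1r powRN.
have Lp : L^-1 * L `^ (- s) = L `^ (- p).
  rewrite -powR_inv1 ?(ltW L0)// -powRD; last by rewrite (gt_eqF L0) implybT.
  by congr (_ `^ _); lra.
rewrite mulrA Lp.
have div (c : nat) : (c%:R / L) `^ p = L `^ (- p) * c%:R `^ p.
  rewrite powRM ?ler0n ?invr_ge0 ?(ltW L0)// mulrC powRN.
  by rewrite -powR_inv1 ?(ltW L0)// -powRrM mulN1r powRN.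
rewrite !div -mulrBr mulrCA ler_wpM2l ?powR_ge0//; exact: sum_powR.
Qed.

Local Notation kappa := (N%:R / L).
Local Notation Lo := (fracS 0 K).
Local Notation Hi := (fracS K N).

(** The numerical fact behind the exponent.  Up to discretisation, the three pieces
    have sizes [U V] (the rest), [1 - U] (the oldest child) and [U (1 - V)] (the
    second child), with [U] and [V] independent and uniform on the unit interval.
    With [T] the moment of order [s] of [U] and [T = Lo + Hi] its splitting at
    [U = 1 / 2], the three classes of pieces have moments [T ^ 2], [(1 + T) Hi] and
    [(1 + T) Lo], and the claim is that their squares add up to more than [1].
    Matching always by age would give [2 T ^ 2 = 288 / 289] instead. *)
Lemma moments_gt1 :
  1003 / 1000 <= (Lo + Hi) ^+ 4 + (kappa + (Lo + Hi)) ^+ 2 * (Lo ^+ 2 + Hi ^+ 2).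
Proof.
have [a Ea] : {a : R | a = 998 / 1000} by eexists.
have [t Et] : {t : R | t = 703 / 1000} by eexists.
have t0 : 0 <= t by lra.
have k0 : a <= kappa.
  have K1 : 1000 <= K%:R :> R by rewrite (ler_nat R 1000).
  rewrite ler_pdivlMr; last exact: L0.
  by rewrite Ea natrD natrM; lra.
have k1 : kappa <= 1 by rewrite ler_pdivrMr// mul1r ler_nat leq_addr.
have kgt : 0 < kappa by apply: lt_le_trans k0; lra.
set x := kappa in k0 k1 kgt *.
have xp : a ^+ 2 <= x `^ p.
  apply: (@le_trans _ _ (x `^ 2)).
    by rewrite powR_mulrn ?(ltW kgt)// lerXn2r ?nnegrE ?(ltW kgt)//; lra.
  by apply: ger_powR; [rewrite kgt|lra].
(* The share of [T] contributed by [U < 1 / 2]; it is at most [3 / 8] because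
   [2 ^ 19 <= 3 ^ 12]. *)
pose hh : R := (1 / 2) `^ p.
have hh0 : 0 < hh by rewrite powR_gt0; lra.
have hh1 : hh <= 3 / 8.
  rewrite -(@ler_pXn2r _ 12)// ?nnegrE; try lra.
  rewrite -powR_mulrn ?(ltW hh0)// -powRrM.
  have -> : p * 12%:R = 17%:R by lra.
  rewrite powR_mulrn; lra.
have Lo1 : 12 / 17 * (x `^ p * hh) <= Lo.
  have := @fracS_ge 0 K (leq0n _); rewrite mul0r powR0; last by apply/eqP; lra.
  rewrite subr0; apply: le_trans; rewrite -powRM; try lra.
  by rewrite /x natrM; have -> : 2 * K%:R / L * (1 / 2) = K%:R / L :> R by lra.
have Hi1 : 12 / 17 * (x `^ p * (1 - hh)) <= Hi.
  have := @fracS_ge K N (leq_pmull K (ltn0Sn 1)); apply: le_trans.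
  rewrite -/x mulrBr mulr1 /hh -powRM; try lra.
  by rewrite /x natrM; have -> : 2 * K%:R / L * (1 / 2) = K%:R / L :> R by lra.
have yt : t <= 12 / 17 * x `^ p.
  apply: (@le_trans _ _ (12 / 17 * a ^+ 2)); first by rewrite Ea Et; lra.
  by rewrite ler_wpM2l//; lra.
have Lo2 : t * hh <= Lo.
  by apply: le_trans Lo1; rewrite mulrA ler_wpM2r// ltW.
have Hi2 : t * (1 - hh) <= Hi.
  by apply: le_trans Hi1; rewrite mulrA ler_wpM2r//; lra.
have T1 : t <= Lo + Hi by lra.
have q1 : t ^+ 2 * (17 / 32) <= Lo ^+ 2 + Hi ^+ 2.
  apply: (@le_trans _ _ ((t * hh) ^+ 2 + (t * (1 - hh)) ^+ 2)).
    rewrite !exprMn -mulrDr; apply: ler_wpM2l; first exact: sqr_ge0.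
    nra.
  have h1 : 0 <= t * hh by rewrite mulr_ge0// ltW.
  have h2 : 0 <= t * (1 - hh) by rewrite mulr_ge0//; lra.
  by apply: lerD; rewrite lerXn2r ?nnegrE ?(le_trans h1 Lo2) ?(le_trans h2 Hi2).
have q2 : t ^+ 4 <= (Lo + Hi) ^+ 4 by rewrite lerXn2r ?nnegrE//; lra.
have q3 : (a + t) ^+ 2 <= (x + (Lo + Hi)) ^+ 2.
  have T0' : 0 <= Lo + Hi := le_trans t0 T1.
  by rewrite lerXn2r ?nnegrE ?lerD//; lra.
have q4 : (a + t) ^+ 2 * (t ^+ 2 * (17 / 32)) <=
    (x + (Lo + Hi)) ^+ 2 * (Lo ^+ 2 + Hi ^+ 2).
  apply: ler_pM => //; first exact: sqr_ge0.
  by rewrite mulr_ge0 ?sqr_ge0//; lra.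
by apply: le_trans (lerD q2 q4); rewrite Ea Et; lra.
Qed.

(** Guaranteed fractions of the pieces when the first split falls into cell [j1]
    and the second into cell [j2].  Which child counts as the big one depends on
    [j1] alone, not on the sizes themselves: this keeps the moments explicit, and
    it gives up little of what a comparison of the sizes would gain. *)
Definition piece_rest (j1 j2 : nat) : R := frac R N j1 * frac R N j2.
Definition piece_oldest (j1 j2 : nat) : R := frac R N (N - j1.+1).
Definition piece_second (j1 j2 : nat) : R := frac R N j1 * frac R N (N - j2.+1).
Definition piece_big (j1 j2 : nat) : R :=
  if (j1 < K)%N then piece_oldest j1 j2 else piece_second j1 j2.
Definition piece_small (j1 j2 : nat) : R :=
  if (j1 < K)%N then piece_second j1 j2 else piece_oldest j1 j2.

Local Notation g := (fun j => frac R N j `^ s).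
Local Notation moment P := (L^-2 * \sum_(j1 < N) \sum_(j2 < N) P j1 j2 `^ s).

Let T0 : fracS 0 N = Lo + Hi.
Proof. by rewrite /fracS -mulrDr -big_cat_nat//; lia. Qed.

Let frac_ge0 j : 0 <= frac R N j. Proof. exact/ltW/frac_gt0. Qed.

Let rev_sum : \sum_(j < N) g (N - j.+1)%N = \sum_(j < N) g j.
Proof. by rewrite [RHS](reindex_inj rev_ord_inj). Qed.

Lemma moment_rest : moment piece_rest = (Lo + Hi) ^+ 2.
Proof.
rewrite -T0 /fracS big_mkord exprMn -exprVn; congr (_ * _).
rewrite expr2 mulr_suml; apply: eq_bigr => i _; rewrite mulr_sumr.
by apply: eq_bigr => j _; rewrite powRM.
Qed.

Let half_sum (a b : nat -> R) :
  \sum_(j < N) (if (j < K)%N then a j else b j) =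
  \sum_(0 <= j < K) a j + \sum_(K <= j < N) b j.
Proof.
rewrite -(big_mkord xpredT (fun j => if (j < K)%N then a j else b j)).
rewrite (@big_cat_nat _ _ _ K)//=; last by lia.
congr (_ + _); apply: eq_big_nat => j /andP[] Kj jK; first by rewrite jK.
by rewrite ltnNge Kj.
Qed.

Let rev_half (a b : nat) : (a <= b)%N -> (b <= N)%N ->
  \sum_(a <= j < b) g (N - j.+1)%N = \sum_(N - b <= j < N - a) g j.
Proof.
move=> ab bN; rewrite big_nat_rev /= -{1}[a]add0n big_addn.
rewrite -[in RHS](add0n (N - b)%N) big_addn.
have -> : (N - a - (N - b) = b - a)%N by lia.
by apply: eq_big_nat => j jba; congr (frac R N _ `^ s); lia.
Qed.

Lemma moment_big : moment piece_big = (kappa + (Lo + Hi)) * Hi.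
Proof.
rewrite -T0.
have -> : \sum_(j1 < N) \sum_(j2 < N) piece_big j1 j2 `^ s =
  \sum_(j1 < N) (if (j1 < K)%N then N%:R * g (N - j1.+1)%N else g j1 * \sum_(j < N) g j).
  apply: eq_bigr => j1 _; rewrite /piece_big; case: (j1 < K)%N.
    by rewrite /piece_oldest sumr_const card_ord -[LHS]mulr_natl.
  by rewrite -rev_sum mulr_sumr; apply: eq_bigr => j2 _; rewrite powRM.
rewrite (half_sum (fun j => N%:R * g (N - j.+1)%N) (fun j => g j * \sum_(j < N) g j)).
rewrite -mulr_sumr -mulr_suml rev_half//; last by lia.
rewrite subn0; have -> : (N - K = K)%N by lia.
rewrite /fracS big_mkord -exprVn; lra.
Qed.

Lemma moment_small : moment piece_small = (kappa + (Lo + Hi)) * Lo.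
Proof.
rewrite -T0.
have -> : \sum_(j1 < N) \sum_(j2 < N) piece_small j1 j2 `^ s =
  \sum_(j1 < N) (if (j1 < K)%N then g j1 * \sum_(j < N) g j else N%:R * g (N - j1.+1)%N).
  apply: eq_bigr => j1 _; rewrite /piece_small; case: (j1 < K)%N; last first.
    by rewrite /piece_oldest sumr_const card_ord -[LHS]mulr_natl.
  by rewrite -rev_sum mulr_sumr; apply: eq_bigr => j2 _; rewrite powRM.
rewrite (half_sum (fun j => g j * \sum_(j < N) g j) (fun j => N%:R * g (N - j.+1)%N)).
rewrite -mulr_sumr -mulr_suml rev_half//; last by lia.
rewrite subnn; have -> : (N - K = K)%N by lia.
rewrite /fracS [X in _ = (_ + L^-1 * X) * _]big_mkord -exprVn; lra.
Qed.

(** Every piece has at least a fraction [L ^- 2] of the tree, so that [jump] bounds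
    the change in one generation of the logarithm of the ratio of two matched
    sizes; [height] is large in comparison, as [tent_sum] demands. *)
Definition jump : R := 2 * ln L.
Definition height : R := 1001 * jump + 1.

Lemma jump_ge0 : 0 <= jump.
Proof. by rewrite mulr_ge0// ln_ge0// ler1n; lia. Qed.

Lemma height_gt0 : 0 < height.
Proof. by have := jump_ge0; rewrite /height; lra. Qed.

Lemma piece_bounds (P : nat -> nat -> R) (j1 j2 : 'I_N) :
  P = piece_rest \/ P = piece_big \/ P = piece_small -> L^-2 <= P j1 j2 <= 1.
Proof.
have f0 (j : nat) : L^-1 <= frac R N j by rewrite /frac ler_peMl ?invr_ge0 ?(ltW L0)// ler1n.
have f1 (j : 'I_N) : frac R N j <= 1 by rewrite frac_le1// ltnW.
have f1' (j : 'I_N) : frac R N (N - j.+1) <= 1 by rewrite frac_le1// leq_subr.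
have iL : 0 <= L^-1 <= 1 by rewrite invr_ge0 (ltW L0) invf_le1 ?L0// ler1n; lia.
have two a b : L^-1 <= a -> a <= 1 -> L^-1 <= b -> b <= 1 -> L^-2 <= a * b <= 1.
  by move=> *; rewrite -exprVn expr2; apply/andP; split; nra.
have one a : L^-1 <= a -> a <= 1 -> L^-2 <= a <= 1.
  by move=> *; rewrite -exprVn expr2; apply/andP; split; nra.
case=> [->|[->|->]]; first by apply: two.
  by rewrite /piece_big /piece_oldest /piece_second; case: ifP => _; [by apply: one|by apply: two].
by rewrite /piece_small /piece_oldest /piece_second; case: ifP => _; [by apply: two|by apply: one].
Qed.

Definition gain (r : R) (P : nat -> nat -> R) (j1 j2 j1' j2' : nat) : R :=
  P j1 j2 `^ s * P j1' j2' `^ s *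
  Num.max 0 (height - `|r + (ln (P j1 j2) - ln (P j1' j2'))|).

Lemma sum_gain (r : R) (P : nat -> nat -> R) : `|r| <= height ->
  P = piece_rest \/ P = piece_big \/ P = piece_small ->
  999 / 1000 * (moment P) ^+ 2 * (height - `|r|) <=
  L^-4 * \sum_(j1 < N) \sum_(j2 < N) \sum_(j1' < N) \sum_(j2' < N) gain r P j1 j2 j1' j2'.
Proof.
move=> rh PP.
have lnP (c : 'I_N * 'I_N) : - jump <= ln (P c.1 c.2) <= 0.
  have /andP[p1 p2] := piece_bounds c.1 c.2 PP.
  have i0 : 0 < L^-2 by rewrite invr_gt0 exprn_gt0.
  rewrite ln_le0// andbT; apply: (@le_trans _ _ (ln (L ^- 2))).
    by rewrite lnV ?posrE ?exprn_gt0// lnXn// /jump mulr_natl.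
  by rewrite ler_ln ?posrE//; exact: lt_le_trans p1.
have DB (c c' : 'I_N * 'I_N) : `|ln (P c.1 c.2) - ln (P c'.1 c'.2)| <= jump.
  by rewrite ler_norml; move: (lnP c) (lnP c') => /andP[? ?] /andP[? ?]; lra.
have := @tent_sum _ (fun c : 'I_N * 'I_N => P c.1 c.2 `^ s) (fun c => ln (P c.1 c.2))
  jump height r (1 / 1000) (fun=> powR_ge0 _ _) DB ltac:(lra) jump_ge0 rh
  ltac:(rewrite /height; lra).
rewrite -(pair_bigA _ (fun j1 j2 : 'I_N => P j1 j2 `^ s)) /=.
set S := \sum_(c : 'I_N * 'I_N) _.
have -> : S = \sum_(j1 < N) \sum_(j2 < N) \sum_(j1' < N) \sum_(j2' < N)
    gain r P j1 j2 j1' j2'.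
  rewrite pair_bigA; apply: eq_bigr => c _.
  by rewrite (pair_bigA _ (fun j1' j2' : 'I_N => gain r P c.1 c.2 j1' j2')).
move=> tent; have i4 : 0 <= L^-4 by rewrite invr_ge0 exprn_ge0// ltW.
have := ler_wpM2l i4 tent; apply: le_trans.
rewrite le_eqVlt; apply/orP; left; apply/eqP; rewrite -!exprVn; lra.
Qed.

(** One generation multiplies the tent by more than one: the surplus in the moments
    outweighs the loss at the tip of the tent. *)
Lemma sum_gain_gt1 (r : R) : `|r| <= height ->
  1001 / 1000 * (height - `|r|) <=
  L^-4 * \sum_(j1 < N) \sum_(j2 < N) \sum_(j1' < N) \sum_(j2' < N)
   (gain r piece_rest j1 j2 j1' j2' + gain r piece_big j1 j2 j1' j2' +
    gain r piece_small j1 j2 j1' j2').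
Proof.
move=> rh.
have := sum_gain rh (or_introl erefl).
have := sum_gain rh (or_intror (or_introl erefl)).
have := sum_gain rh (or_intror (or_intror erefl)).
rewrite moment_rest moment_big moment_small.
have split4 (f1 f2 f3 : nat -> nat -> nat -> nat -> R) :
  \sum_(j1 < N) \sum_(j2 < N) \sum_(j1' < N) \sum_(j2' < N)
    (f1 j1 j2 j1' j2' + f2 j1 j2 j1' j2' + f3 j1 j2 j1' j2') =
  \sum_(j1 < N) \sum_(j2 < N) \sum_(j1' < N) \sum_(j2' < N) f1 j1 j2 j1' j2' +
  \sum_(j1 < N) \sum_(j2 < N) \sum_(j1' < N) \sum_(j2' < N) f2 j1 j2 j1' j2' +
  \sum_(j1 < N) \sum_(j2 < N) \sum_(j1' < N) \sum_(j2' < N) f3 j1 j2 j1' j2'.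
  rewrite -!big_split; apply: eq_bigr => j1 _; rewrite -!big_split; apply: eq_bigr => j2 _.
  rewrite -!big_split; apply: eq_bigr => j1' _; rewrite -!big_split.
  by apply: eq_bigr.
rewrite split4 !(mulrDr (L ^- 4)).
set A := L^-4 * _; set B := L^-4 * _; set C := L^-4 * _ => hC hB hA.
have hr : 0 <= height - `|r| by rewrite subr_ge0.
have := ler_wpM2r hr moments_gt1.
rewrite (exprM (Lo + Hi) 2 2 : (Lo + Hi) ^+ 4 = _).
move: hA hB hC hr; set H := height - `|r|; rewrite !(exprMn _ (kappa + (Lo + Hi))).
set x := (kappa + _) ^+ 2; set y := (Lo + Hi) ^+ 2; set z := Lo ^+ 2; set w := Hi ^+ 2.
lra.
Qed.
End Moments.
End Analysis.

(** * Large common subtrees with positive probability *)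

Section Survival.
Variable R : realType.
Local Notation s := (5 / 12 : R).

(** The probability that no vertex of the best matching of two independent trees is
    marked, when each is marked with probability [lam]. *)
Definition pgf (lam : R) (i i' : nat) : R :=
  rrt i' (fun t' => rrt i (fun t => (1 - lam) ^+ best_match t t')).

Lemma pgf_ge0 (lam : R) i i' : lam <= 1 -> 0 <= pgf lam i i'.
Proof. by move=> lam1; do 2 apply: rrt_ge0 => ?; rewrite exprn_ge0// subr_ge0. Qed.

Lemma pgf_le (lam : R) i i' : 0 <= lam <= 1 -> pgf lam i i' <= 1 - lam.
Proof.
move=> /andP[lam0 lam1].
have cst k (a : R) : rrt k (fun=> a) = a by exact: mean_cst.
rewrite -[leRHS](cst i'); apply: rrt_le => t'.
rewrite -[leRHS](cst i); apply: rrt_le => t.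
rewrite -(prednK (best_match_gt0 t t')) exprS ler_piMr ?subr_ge0//.
by rewrite exprn_ile1 ?subr_ge0// gerBl.
Qed.

(** For independent events of probability at most [e], the union bound loses no more
    than a factor [1 - e]. *)
Lemma union3_ge (e u1 u2 u3 x1 x2 x3 : R) : e <= 1 ->
  0 <= x1 <= e -> 0 <= x2 <= e -> 0 <= x3 <= e ->
  0 <= u1 <= 1 - x1 -> 0 <= u2 <= 1 - x2 -> 0 <= u3 <= 1 - x3 ->
  (1 - e) * (x1 + x2 + x3) <= 1 - u1 * u2 * u3.
Proof.
move=> e1 /andP[x10 x1e] /andP[x20 x2e] /andP[x30 x3e].
move=> /andP[u10 u1x] /andP[u20 u2x] /andP[u30 u3x].
have : u1 * u2 * u3 <= (1 - x1) * (1 - x2) * (1 - x3).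
  by apply: ler_pM => //; [exact: mulr_ge0|apply: ler_pM].
have : 0 <= x1 * x2 * x3 by rewrite !mulr_ge0.
have : x1 * x2 <= e * (x1 + x2) / 2 by nra.
have : x2 * x3 <= e * (x2 + x3) / 2 by nra.
have : x1 * x3 <= e * (x1 + x3) / 2 by nra.
lra.
Qed.

Variable K : nat.
Hypothesis K1000 : (1000 <= K)%N.
Local Notation N := (2 * K)%N.
Local Notation L := ((N + 3)%:R : R).
Local Notation height := (height R K).
Local Notation rest := (piece_rest R K).
Local Notation big := (piece_big R K).
Local Notation small := (piece_small R K).
Local Notation thr := ((N + 3) ^ 3 + (N + 3))%N.

(** The tent is zero unless the two sizes are comparable, so that the weight is bounded
    as soon as one of them is; a lower bound for common subtrees has to have this
    property, as a small tree and a huge one have only small common subtrees. *)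
Definition weight (x y : R) : R :=
  (x * y) `^ s * Num.max 0 (height - `|ln x - ln y|).

Lemma weight_scale (P : nat -> nat -> R) j1 j2 j1' j2' x y : 0 < x -> 0 < y ->
  0 < P j1 j2 -> 0 < P j1' j2' ->
  weight (P j1 j2 * x) (P j1' j2' * y) =
  (x * y) `^ s * gain K (ln x - ln y) P j1 j2 j1' j2'.
Proof.
move=> x0 y0 p0 p'0.
rewrite /weight /gain mulrACA !lnM ?posrE// opprD addrACA [ln (P _ _) - _ + _]addrC.
rewrite (powRM _ (mulr_ge0 (ltW p0) (ltW p'0)) (mulr_ge0 (ltW x0) (ltW y0))).
by rewrite (powRM _ (ltW p0) (ltW p'0)) -mulrA mulrCA.
Qed.

Lemma rest_gt0 j1 j2 : 0 < rest j1 j2.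
Proof. by rewrite mulr_gt0 ?frac_gt0. Qed.

Lemma big_gt0 j1 j2 : 0 < big j1 j2.
Proof. by rewrite /piece_big; case: ifP => _; rewrite ?mulr_gt0 ?frac_gt0. Qed.

Lemma small_gt0 j1 j2 : 0 < small j1 j2.
Proof. by rewrite /piece_small; case: ifP => _; rewrite ?mulr_gt0 ?frac_gt0. Qed.

Section Comparison.
Variables lam c X e : R.
Hypothesis lam01 : 0 <= lam <= 1.
Hypothesis c0 : 0 <= c.
Hypothesis e01 : 0 <= e <= 1 / 2000.
Hypothesis weight_small : forall x y, 0 < x -> 0 < y ->
  x < thr%:R \/ y < thr%:R -> c * weight x y <= 1.
Hypothesis weight_large : forall x y, 0 < x <= X -> 0 < y <= X ->
  lam * (c * weight x y) <= e.

(** Induction on the size of the first tree.  When one of the sizes is small, the claim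
    holds because a matching has at least one vertex.  When both are large, one
    generation of splitting multiplies the sum of the weights by more than what the
    factor [1 - e] of [union3_ge] takes away; this factor is available because, up to
    the fixed size [X], the claimed lower bounds never exceed [e]. *)
Lemma pgf_weight k k' x y : 0 < x <= X -> 0 < y <= X ->
  x <= k.+1%:R -> y <= k'.+1%:R -> pgf lam k k' <= 1 - lam * (c * weight x y).
Proof.
have [m] := ubnP k; elim: m k k' x y => // m IH k k' x y; rewrite ltnS => km.
move=> /andP[x0 xX] /andP[y0 yX] xk yk'.
have /andP[lam0 lam1] := lam01; have /andP[e0 e1] := e01.
have triv : c * weight x y <= 1 -> pgf lam k k' <= 1 - lam * (c * weight x y).
  move=> cw; apply: (le_trans (pgf_le k k' lam01)).
  by rewrite lerD2l lerN2 ler_piMr.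
have [xt|tx] := ltP x thr%:R; first by apply/triv/weight_small => //; left.
have [yt|ty] := ltP y thr%:R; first by apply/triv/weight_small => //; right.
have [hr|rh] := ltP height `|ln x - ln y|.
  apply: triv; rewrite /weight (_ : Num.max _ _ = 0) ?mulr0//.
  by apply: max_l; rewrite subr_le0 ltW.
have kt : (thr <= k.+1)%N by rewrite -(ler_nat R) (le_trans tx).
have k't : (thr <= k'.+1)%N by rewrite -(ler_nat R) (le_trans ty).
pose w (P : nat -> nat -> R) j1 j2 j1' j2' := lam * (c * weight (P j1 j2 * x) (P j1' j2' * y)).
have w0 (P : nat -> nat -> R) j1 j2 j1' j2' : 0 <= w P j1 j2 j1' j2'.
  by rewrite !mulr_ge0 ?powR_ge0// le_max lexx.
pose b j1 j2 j1' j2' := (1 - e) *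
  (w rest j1 j2 j1' j2' + w big j1 j2 j1' j2' + w small j1 j2 j1' j2').
have e1' : 0 <= 1 - e by lra.
pose D t t' := 1 - (1 - lam) ^+ best_match t t'.
have D0 t t' : 0 <= D t t'.
  by rewrite subr_ge0 exprn_ile1 ?subr_ge0// gerBl.
have DE : rrt k (fun t => rrt k' (D t)) = 1 - pgf lam k k'.
  rewrite rrt_exchange -[pgf _ _ _]mul1r -rrt_1sub; apply: mean_ext => t'.
  by rewrite mul1r -[X in _ = 1 - X]mul1r -rrt_1sub; apply: mean_ext => t; rewrite mul1r.
rewrite lerBrDr addrC -lerBrDr -DE.
have key := @rrt_pair_cells2 R N k k' D b kt k't D0.
apply: le_trans (key _ _).
- have sumE : (N + 3)%:R^-4 * \sum_(j1 < N) \sum_(j2 < N) \sum_(j1' < N) \sum_(j2' < N)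
      b j1 j2 j1' j2' = (1 - e) * (lam * (c * (x * y) `^ s)) *
    (L ^- 4 * \sum_(j1 < N) \sum_(j2 < N) \sum_(j1' < N) \sum_(j2' < N)
      (gain K (ln x - ln y) rest j1 j2 j1' j2' + gain K (ln x - ln y) big j1 j2 j1' j2' +
       gain K (ln x - ln y) small j1 j2 j1' j2')).
    rewrite [RHS]mulrCA; congr (_ * _).
    do 4 (rewrite mulr_sumr; apply: eq_bigr => ? _).
    rewrite /b /w !weight_scale ?rest_gt0 ?big_gt0 ?small_gt0//; lra.
  rewrite sumE; set A := (x * y) `^ s.
  have A0 : 0 <= lam * (c * A) by rewrite !mulr_ge0 ?powR_ge0.
  have -> : lam * (c * weight x y) = (lam * (c * A)) * (height - `|ln x - ln y|).
    rewrite /weight max_r ?subr_ge0// -/A; lra.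
  have := sum_gain_gt1 K1000 rh; set G := _ * bigop _ _ _ => hG.
  rewrite (mulrAC (1 - e)) (mulrC _ (lam * _)); apply: ler_wpM2l => //.
  have hh : 0 <= height - `|ln x - ln y| by rewrite subr_ge0.
  apply: le_trans (ler_wpM2l e1' hG).
  have [d Ed] : {d : R | d = 1001 / 1000} by eexists.
  rewrite -Ed mulrA ler_peMl//; nra.
- move=> j1 j2 j1' j2'; apply: mulr_ge0 => //.
  by apply: addr_ge0; [apply: addr_ge0|]; exact: w0.
move=> {key} j1 j2 j1' j2' i1 i2 i3 i1' i2' i3' l1 l2 l3 h1 h2 h3 h1' h2' h3'.
have le_frac a i x' k0 : 0 <= a -> x' <= k0.+1%:R -> a * k0.+1%:R <= i.+1%:R ->
    a * x' <= i.+1%:R :> R.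
  by move=> a0 xk0; apply: le_trans; apply: (ler_wpM2l a0 xk0).
have le_X (P : nat -> nat -> R) (i i' : 'I_N) z : P = rest \/ P = big \/ P = small ->
    0 < P i i' -> 0 < z -> z <= X -> 0 < P i i' * z <= X.
  move=> PP P0 z0 zX; have /andP[_ P1] := piece_bounds K1000 i i' PP.
  by rewrite mulr_gt0//= (le_trans _ zX)// ler_piMl// ltW.
have rR : rest = rest \/ rest = big \/ rest = small by left.
have rB : big = rest \/ big = big \/ big = small by right; left.
have rS : small = rest \/ small = big \/ small = small by right; right.
have we Q : Q = rest \/ Q = big \/ Q = small -> (forall j j', 0 < Q j j') ->
    0 <= w Q j1 j2 j1' j2' <= e.
  by move=> QQ Q0; apply/andP; split; [exact: w0|apply: weight_large; exact: le_X].
have [wr wb ws] := And3 (we _ rR rest_gt0) (we _ rB big_gt0) (we _ rS small_gt0).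
have e1'' : e <= 1 by rewrite -subr_ge0.
have step Q i i' : Q = rest \/ Q = big \/ Q = small -> (forall j j', 0 < Q j j') ->
    (i < k)%N -> Q j1 j2 * k.+1%:R <= i.+1%:R -> Q j1' j2' * k'.+1%:R <= i'.+1%:R ->
    0 <= pgf lam i i' <= 1 - w Q j1 j2 j1' j2'.
  move=> QQ Q0 ik Qk Qk'; rewrite pgf_ge0//=; apply: IH.
  - by rewrite (leq_trans ik).
  - by apply: le_X.
  - by apply: le_X.
  - exact: (le_frac _ _ _ _ (ltW (Q0 _ _)) xk Qk).
  - exact: (le_frac _ _ _ _ (ltW (Q0 _ _)) yk' Qk').
have srest : 0 <= pgf lam i1 i1' <= 1 - w rest j1 j2 j1' j2'.
  by apply: step => //; exact: rest_gt0.
have sbig i i' := step big i i' rB big_gt0.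
have ssmall i i' := step small i i' rS small_gt0.
pose q t t' : R := (1 - lam) ^+ best_match t t'.
have q01 : 0 <= 1 - lam <= 1 by rewrite subr_ge0 lam1 gerBl.
have qle a a' : (a <= a')%N -> (1 - lam) ^+ a' <= (1 - lam) ^+ a.
  by move=> aa'; apply: ler_wiXn2l => //; case/andP: q01.
have keep : b j1 j2 j1' j2' <= 1 - pgf lam i1 i1' * pgf lam i2 i2' * pgf lam i3 i3' ->
    b j1 j2 j1' j2' <= rrt i1' (fun t' => rrt i2' (fun r2' => rrt i3' (fun r1' =>
       rrt i1 (fun t => rrt i2 (fun r2 => rrt i3 (fun r1 =>
         D (Join (Join t r2) r1) (Join (Join t' r2') r1'))))))).
  move=> /le_trans; apply; rewrite -(@rrt_prod3 R i1 i2 i3 i1' i2' i3' q q q).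
  do 6 (apply: rrt_le => ?); rewrite /D lerD2l lerN2 /q -!exprD.
  apply: qle; apply: leq_trans (best_match_join _ _ _ _); rewrite leq_add2r.
  exact: best_match_join.
have swap : b j1 j2 j1' j2' <= 1 - pgf lam i1 i1' * pgf lam i2 i3' * pgf lam i3 i2' ->
    b j1 j2 j1' j2' <= rrt i1' (fun t' => rrt i2' (fun r2' => rrt i3' (fun r1' =>
       rrt i1 (fun t => rrt i2 (fun r2 => rrt i3 (fun r1 =>
         D (Join (Join t r2) r1) (Join (Join t' r2') r1'))))))).
  move=> /le_trans; apply; rewrite -(@rrt_prod3 R i1 i2 i3 i1' i3' i2' q q q).
  apply: rrt_le => t'; rewrite rrt_exchange.
  do 5 (apply: rrt_le => ?); rewrite /D lerD2l lerN2 /q -!exprD.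
  by apply: qle; apply: leq_trans (best_match_swap _ _ _ _ _ _); rewrite addnAC.
have [jK|jK] := ltnP j1 K; have [jK'|jK'] := ltnP j1' K.
- apply: keep; rewrite /b -[leRHS]/(1 - _ * _ * _) addrAC.
  apply: union3_ge => //; [apply: ssmall|apply: sbig] => //;
    by rewrite /piece_small /piece_big ?jK ?jK'.
- apply: swap; rewrite /b addrAC.
  apply: union3_ge => //; [apply: ssmall|apply: sbig] => //;
    by rewrite /piece_small /piece_big ?jK 1?ltnNge ?jK'.
- apply: swap; rewrite /b.
  apply: union3_ge => //; [apply: sbig|apply: ssmall] => //;
    by rewrite /piece_small /piece_big ?jK' 1?ltnNge ?jK.
- apply: keep; rewrite /b.
  apply: union3_ge => //; [apply: sbig|apply: ssmall] => //;
    by rewrite /piece_small /piece_big 2?ltnNge ?jK ?jK'.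
Qed.
End Comparison.
End Survival.

(** * From positive probability to probability close to one *)

Section Boost.
Variable R : realType.
Local Notation s := (5 / 12 : R).

Definition below (x : R) (k k' : nat) : R :=
  rrt k' (fun t' => rrt k (fun t => ((best_match t t')%:R < x)%R%:R)).

(** Common subtrees of order a constant times [n ^ (5 / 6)] are missing with
    probability at most [y] in all large trees. *)
Definition rarely_below (y : R) : Prop :=
  exists theta X0 : R, [/\ 0 < theta, 0 < X0 &
    forall X k k', X0 <= X -> X <= k.+1%:R -> X <= k'.+1%:R ->
      below (theta * (X * X) `^ s) k k' <= y].

Lemma bernoulli (a : R) (n : nat) : 0 <= a <= 1 -> 1 - a * n%:R <= (1 - a) ^+ n.
Proof.
move=> /andP[a0 a1]; elim: n => [|n IH]; first by rewrite mulr0 subr0 expr0.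
rewrite exprS; have := ler_wpM2l (_ : 0 <= 1 - a) IH; rewrite subr_ge0 => /(_ a1).
apply: le_trans; rewrite -natr1; have : 0 <= a * a * n%:R by rewrite !mulr_ge0.
lra.
Qed.

(** If the matching has fewer than [x] vertices, then a mark is left with
    probability at most [lam * x]. *)
Lemma below_pgf (lam x : R) k k' : 0 <= lam <= 1 -> 0 <= x ->
  below x k k' <= lam * x + pgf lam k k'.
Proof.
move=> lam01 x0; have /andP[lam0 lam1] := lam01.
have cst i (a : R) (F : rtree unit -> R) : a + rrt i F = rrt i (fun t => a + F t).
  by rewrite /rrt meanD mean_cst.
rewrite /pgf cst; apply: rrt_le => t'; rewrite cst; apply: rrt_le => t.
have q0 : 0 <= (1 - lam) ^+ best_match t t' by rewrite exprn_ge0// subr_ge0.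
have [bx|_] := ltP; last by rewrite addr_ge0// mulr_ge0.
have := bernoulli (best_match t t') lam01.
have := ler_wpM2l lam0 (ltW bx); rewrite mulr1n; lra.
Qed.

Section Positive.
Variable K : nat.
Hypothesis K1000 : (1000 <= K)%N.
Local Notation N := (2 * K)%N.
Local Notation height := (height R K).
Local Notation thr := (((N + 3) ^ 3 + (N + 3))%N%:R : R).
Local Notation weight := (@weight R K).

Lemma thr_gt0 : 0 < thr.
Proof. by rewrite ltr0n addn_gt0 addn3 orbT. Qed.

Definition weight_bound : R := (thr * thr * expR height) `^ s * height.

Lemma weight_bound_gt0 : 0 < weight_bound.
Proof.
apply: mulr_gt0; last exact: height_gt0.
apply: powR_gt0; apply: mulr_gt0; last exact: expR_gt0.
by apply: mulr_gt0; exact: thr_gt0.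
Qed.

Lemma weightC x y : weight x y = weight y x.
Proof. by rewrite /weight (mulrC x) distrC. Qed.

Lemma weight_le (x y z : R) : 0 < x -> 0 < y -> x * y <= z ->
  weight x y <= z `^ s * height.
Proof.
move=> x0 y0 xyz; apply: ler_pM; rewrite ?powR_ge0 ?le_max ?lexx//.
  have xy0 : 0 <= x * y by rewrite mulr_ge0// ltW.
  have z0 := le_trans xy0 xyz.
  by apply: ge0_ler_powR; rewrite ?nnegrE//; lra.
by rewrite ge_max gerBl (ltW (height_gt0 R K1000)) normr_ge0.
Qed.

Lemma weight_small x y : 0 < x -> 0 < y -> x < thr \/ y < thr ->
  weight_bound^-1 * weight x y <= 1.
Proof.
have wlog1 u v : 0 < u -> 0 < v -> u < thr -> weight_bound^-1 * weight u v <= 1.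
  move=> u0 v0 ut; rewrite ler_pdivrMl ?weight_bound_gt0// mulr1.
  have [far|near] := leP height `|ln u - ln v|.
    by rewrite /weight max_l ?subr_le0// mulr0 ltW// weight_bound_gt0.
  apply: weight_le => //.
  have vu : v <= u * expR height.
    rewrite -[u]lnK ?posrE// -expRD -[v]lnK ?posrE// ler_expR.
    by move: near; rewrite ltr_norml; lra.
  rewrite -mulrA; apply: ler_pM; rewrite ?ltW//.
  apply: (lt_le_trans _ (_ : thr * expR height <= _)) => //.
  by apply: (le_lt_trans vu); rewrite ltr_pM2r ?expR_gt0.
by move=> x0 y0 [xt|yt]; [|rewrite weightC]; apply: wlog1.
Qed.

(** For trees of order at least [X], the mark probability is tuned so that a mark is
    left with probability at least [1 / 2000]; at most half of that can come from
    matchings with fewer than [theta * (X * X) `^ s] vertices. *)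
Lemma rarely_below_lt1 : rarely_below (1 - 1 / 4000).
Proof.
have hg := height_gt0 R K1000; have wb := weight_bound_gt0.
exists (weight_bound^-1 * height / 2), (thr * expR height); split.
- by rewrite divr_gt0// mulr_gt0// invr_gt0.
- by rewrite mulr_gt0 ?thr_gt0 ?expR_gt0.
move=> X k k' X0 Xk Xk'.
have Xgt : 0 < X by apply: lt_le_trans X0; rewrite mulr_gt0 ?thr_gt0 ?expR_gt0.
set A := (X * X) `^ s.
have A0 : 0 < A by rewrite powR_gt0// mulr_gt0.
pose m := weight_bound^-1 * (A * height).
have m1 : 1 <= m.
  rewrite /m ler_pdivlMl// mulr1 /weight_bound; apply: ler_wpM2r; first exact: ltW.
  have t0 := thr_gt0; have e1 : 1 <= expR height by rewrite -expR0 ler_expR ltW.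
  have tX : thr <= X by apply: le_trans X0; rewrite ler_peMr// ltW.
  have te : 0 <= thr * expR height by rewrite mulr_ge0 ?expR_ge0// ltW.
  apply: ge0_ler_powR; [lra|rewrite nnegrE -mulrA mulr_ge0// ltW//|
    by rewrite nnegrE mulr_ge0// ltW|].
  by rewrite -mulrA; apply: ler_pM => //; exact: ltW.
have [e Ee] : {e : R | e = 1 / 2000} by eexists.
have e0 : 0 < e by rewrite Ee; lra.
have e1 : e <= 1 by rewrite Ee; lra.
have m0 : 0 < m by exact: lt_le_trans m1.
have em : 0 <= e / m <= 1.
  by rewrite divr_ge0 ?(ltW e0) ?(ltW m0)//= ler_pdivrMr// mul1r (le_trans e1).
have wX : weight X X = A * height by rewrite /weight subrr normr0 subr0 max_r// ltW.
have := @pgf_weight R K K1000 (e / m) weight_bound^-1 X e em _ _ weight_small _ k k' X X.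
rewrite !Xgt !lexx wX -/m divfK ?gt_eqF// => pgfX.
apply: (@le_trans _ _ (e / m * (weight_bound^-1 * height / 2 * A) + pgf (e / m) k k')).
  by apply: below_pgf; rewrite // !mulr_ge0 ?invr_ge0 ?ltW.
have -> : e / m * (weight_bound^-1 * height / 2 * A) = e / 2.
  rewrite (_ : weight_bound^-1 * height / 2 * A = m / 2); last by rewrite /m; lra.
  by rewrite mulrA divfK ?gt_eqF.
suff : pgf (e / m) k k' <= 1 - e by rewrite Ee; lra.
apply: pgfX => //.
- by rewrite invr_ge0 ltW.
- by rewrite (ltW e0) Ee; lra.
- move=> x y /andP[x0 xX] /andP[y0 yX].
  rewrite -{2}(divfK (lt0r_neq0 m0) e); apply: ler_wpM2l; first by case/andP: em.
  rewrite /m; apply: ler_wpM2l; first by rewrite invr_ge0 ltW.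
  by apply: weight_le => //; apply: ler_pM => //; exact: ltW.
Qed.
End Positive.

Lemma rrt_pair_cells (N k k' : nat) (D : rtree unit -> rtree unit -> R) (b : R) :
  ((N + 3) ^ 2 <= k)%N -> ((N + 3) ^ 2 <= k')%N ->
  (forall t t', 0 <= D t t') -> 0 <= b ->
  (forall i1 i2 i1' i2',
     k.+1%:R <= (N + 3)%:R * i1.+1%:R :> R -> k.+1%:R <= (N + 3)%:R * i2.+1%:R :> R ->
     k'.+1%:R <= (N + 3)%:R * i1'.+1%:R :> R -> k'.+1%:R <= (N + 3)%:R * i2'.+1%:R :> R ->
     b <= rrt i1' (fun l' => rrt i2' (fun r' =>
       rrt i1 (fun l => rrt i2 (fun r => D (Join l r) (Join l' r')))))) ->
  (N%:R / (N + 3)%:R) ^+ 2 * b <= rrt k' (fun t' => rrt k (fun t => D t t')).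
Proof.
move=> Nk Nk' D0 b0 bD.
have L0 : 0 < (N + 3)%:R :> R by rewrite ltr0n addn3.
have fracL j (a c : R) : 0 <= a -> frac R N j * a <= c -> a <= (N + 3)%:R * c.
  move=> a0; rewrite /frac mulrAC ler_pdivrMr// (mulrC c); apply: le_trans.
  by rewrite ler_peMl// ler1n.
have cstE (a : R) : N%:R / (N + 3)%:R * a = (N + 3)%:R^-1 * \sum_(j < N) a.
  by rewrite sumr_const card_ord -[X in _ = _ * X]mulr_natl mulrA (mulrC _^-1).
rewrite expr2 -mulrA cstE.
have a0 : 0 <= N%:R / (N + 3)%:R * b by rewrite mulr_ge0// divr_ge0.
apply: (@rrt_cells R N k' _ (fun=> N%:R / (N + 3)%:R * b)) => //.
  by move=> t'; exact: rrt_ge0.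
move=> j' i1' i2' _ _ h1' h2'.
have -> : rrt i1' (fun l' => rrt i2' (fun r' => rrt k (fun t => D t (Join l' r')))) =
    rrt k (fun t => rrt i1' (fun l' => rrt i2' (fun r' => D t (Join l' r')))).
  rewrite [RHS]rrt_exchange; apply: mean_ext => l'.
  by rewrite -/(rrt _ _) -/(rrt _ _) [RHS]rrt_exchange.
rewrite cstE; apply: (@rrt_cells R N k _ (fun=> b)) => //.
  by move=> t; do 2 apply: rrt_ge0 => ?.
move=> j i1 i2 _ _ h1 h2.
have -> : rrt i1 (fun l => rrt i2 (fun r => rrt i1' (fun l' => rrt i2' (fun r' =>
      D (Join l r) (Join l' r'))))) =
    rrt i1' (fun l' => rrt i2' (fun r' => rrt i1 (fun l => rrt i2 (fun r =>
      D (Join l r) (Join l' r'))))).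
  have ext k0 F F' : (forall s, F s = F' s) -> rrt k0 F = rrt k0 F' :> R by exact: mean_ext.
  transitivity (rrt i1 (fun l => rrt i1' (fun l' => rrt i2' (fun r' => rrt i2 (fun r =>
      D (Join l r) (Join l' r')))))).
    apply: (ext) => l; rewrite rrt_exchange; apply: (ext) => l'; exact: rrt_exchange.
  by rewrite rrt_exchange; apply: (ext) => l'; exact: rrt_exchange.
by apply: bD; [exact: fracL h1|exact: fracL h2|exact: fracL h1'|exact: fracL h2'].
Qed.

(** The subtree of the oldest child and the rest of the tree give two independent
    attempts at finding a large common subtree, unless the split falls into one of
    the discarded extreme cells. *)
Lemma rarely_below_square (y : R) (N : nat) : 0 <= y <= 1 -> rarely_below y ->
  rarely_below (1 - (N%:R / (N + 3)%:R) ^+ 2 * (1 - y ^+ 2)).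
Proof.
move=> /andP[y0 y1] [theta [X0 [theta0 X00 lowy]]].
have [L EL] : {L : R | L = (N + 3)%:R} by eexists.
have L1 : 1 <= L by rewrite EL ler1n addn3.
have L0 : 0 < L by exact: lt_le_trans L1.
exists (theta * (L^-1 * L^-1) `^ s), (L * X0 + L ^+ 2 + 1); split.
- by rewrite mulr_gt0// powR_gt0// mulr_gt0// invr_gt0.
- by rewrite !addr_gt0// ?mulr_gt0// exprn_gt0.
move=> X k k' hX Xk Xk'.
have X0' : 0 < X by apply: lt_le_trans hX; rewrite !addr_gt0// ?mulr_gt0// exprn_gt0.
pose Y := X / L.
have Y0 : X0 <= Y.
  rewrite ler_pdivlMr// mulrC; apply: le_trans hX.
  by rewrite -addrA lerDl addr_ge0// exprn_ge0// ltW.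
have -> : theta * (L^-1 * L^-1) `^ s * (X * X) `^ s = theta * (Y * Y) `^ s.
  by rewrite -mulrA -powRM ?mulr_ge0 ?invr_ge0 ?(ltW L0, ltW X0')// /Y; congr (_ * _ `^ _); lra.
set x := theta * _.
pose q t t' : R := ((best_match t t')%:R < x)%R%:R.
have q01 t t' : 0 <= q t t' <= 1 by rewrite /q; case: ltP; rewrite ler01 lexx.
have large i : X <= i.+1%:R -> ((N + 3) ^ 2 <= i)%N.
  move=> Xi; rewrite -ltnS -(ltr_nat R) natrX -EL; apply: lt_le_trans Xi.
  apply: lt_le_trans hX; have := mulr_gt0 L0 X00; lra.
have -> : below x k k' = 1 - rrt k' (fun t' => rrt k (fun t => 1 - q t t')).
  have e1 t' : rrt k (fun t => 1 - q t t') = 1 - rrt k (q^~ t').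
    rewrite -[X in _ = 1 - X]mul1r -rrt_1sub; apply: mean_ext => t; by rewrite mul1r.
  rewrite (_ : (fun t' => _) = (fun t' => 1 - 1 * rrt k (q^~ t'))).
    by rewrite rrt_1sub mul1r opprB addrC subrK.
  by apply/funext => t'; rewrite e1 mul1r.
rewrite lerD2l lerN2; apply: rrt_pair_cells; [exact: large|exact: large|..].
- by move=> t t'; have /andP[_] := q01 t t'; rewrite subr_ge0.
- by rewrite subr_ge0 exprn_ile1.
rewrite -EL => i1 i2 i1' i2' h1 h2 h1' h2'.
have Yle i j : X <= i.+1%:R -> i.+1%:R <= L * j.+1%:R -> Y <= j.+1%:R.
  by move=> Xi ij; rewrite ler_pdivrMr// mulrC (le_trans Xi).
have b1 := lowy _ _ _ Y0 (Yle _ _ Xk h1) (Yle _ _ Xk' h1').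
have b2 := lowy _ _ _ Y0 (Yle _ _ Xk h2) (Yle _ _ Xk' h2').
rewrite -/x in b1 b2.
have below0 i j : 0 <= below x i j by do 2 apply: rrt_ge0 => ?; exact: ler0n.
apply: (@le_trans _ _ (1 - below x i1 i1' * below x i2 i2' * 1)).
  by rewrite mulr1 lerD2l lerN2 expr2; apply: ler_pM.
have := @rrt_prod3 R i1 i2 0 i1' i2' 0 q q (fun _ _ => 1).
rewrite -/(below x i1 i1') -/(below x i2 i2') => <-.
do 2 (apply: rrt_le => ?); rewrite /rrt /=; do 2 (apply: mean_le => ?).
rewrite mulr1 lerD2l lerN2 /q.
set m := best_match (Join _ _) _.
have [mx|_] := ltP m%:R; last by rewrite -natrM ler0n.
have lt_x a : (a <= m)%N -> (a%:R < x) by move=> am; apply: le_lt_trans mx; rewrite ler_nat.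
have mJ := best_match_join _ _ _ _ : (_ <= m)%N.
rewrite !lt_x ?mulr1//; apply: leq_trans mJ; [exact: leq_addl|exact: leq_addr].
Qed.

(** With [N] large, squaring sends [y] below [y * (1 + y) / 2]; iterating this drives
    the probability of failure to zero. *)
Lemma rarely_below_all (y : R) : 0 < y -> rarely_below y.
Proof.
move=> y_gt0.
have mono (a b : R) : a <= b -> rarely_below a -> rarely_below b.
  move=> ab [theta [X0 [? ? h]]]; exists theta, X0; split=> // X k k' *.
  by apply: le_trans ab; exact: h.
have [y1 Ey1] : {y1 : R | y1 = 1 - 1 / 4000} by eexists.
have start : rarely_below y1.
  by rewrite Ey1; exact: (@rarely_below_lt1 1000%N (leqnn _)).
have y10 : 0 < y1 by rewrite Ey1; lra.
have y11 : y1 < 1 by rewrite Ey1; lra.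
pose r := (1 + y1) / 2.
have r0 : 0 < r by rewrite /r; lra.
have r1 : r < 1 by rewrite /r; lra.
have step k : rarely_below (y1 * r ^+ k).
  elim: k => [|k IH]; first by rewrite expr0 mulr1.
  set z := y1 * r ^+ k in IH.
  have z0 : 0 < z by rewrite mulr_gt0// exprn_gt0.
  have zy : z <= y1 by rewrite ler_piMr ?(ltW y10)// exprn_ile1// ltW.
  (* The share of kept cells for which the probability of failure
     [1 - a * (1 - z ^+ 2)] is [z * (1 + z) / 2]. *)
  pose a := (2 + z) / (2 + 2 * z).
  have a0 : 0 < a by rewrite divr_gt0; lra.
  have a1 : a < 1 by rewrite ltr_pdivrMr; lra.
  have [N Na] : exists N : nat, a <= (N%:R / (N + 3)%:R) ^+ 2.
    have [N N1] : exists N : nat, 6 / (1 - a) < N.+1%:R.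
      by exists (Num.truncn (6 / (1 - a))); exact: truncnS_gt.
    exists N; move: N1; rewrite ltr_pdivrMr ?subr_gt0//.
    rewrite expr_div_n ler_pdivlMr ?exprn_gt0 ?ltr0n ?addn3//.
    rewrite -addn3 -addn1 !natrD; have : 0 <= N%:R :> R by [].
    nra.
  have := rarely_below_square N (_ : 0 <= z <= 1) IH.
  rewrite (ltW z0) (le_trans zy (ltW y11)) => /(_ isT).
  apply: mono.
  rewrite (exprSr r k) mulrA -/z.
  have aE : a * (1 - z ^+ 2) = (1 - z) * (2 + z) / 2.
    have -> : 1 - z ^+ 2 = (2 + 2 * z) * ((1 - z) / 2) by lra.
    by rewrite /a mulrA divfK; lra.
  have z1 : z <= 1 := le_trans zy (ltW y11).
  have z2 : 0 <= 1 - z ^+ 2 by rewrite subr_ge0 exprn_ile1// ltW.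
  have := ler_wpM2r z2 Na; rewrite aE /r; set M := (_ ^+ 2 * _).
  have := ler_wpM2l (ltW z0) zy; lra.
have [k hk] : exists k, y1 * r ^+ k <= y.
  have cv : (fun n => r ^+ n) @ \oo --> 0.
    by apply: cvg_expr; rewrite ger0_norm// ltW.
  move/cvgrPdist_lt: cv => /(_ y y_gt0)[n _ /(_ n (leqnn n))].
  rewrite /= sub0r normrN ger0_norm ?exprn_ge0 ?(ltW r0)// => rn.
  exists n; apply: le_trans (ltW rn); rewrite ler_piMl ?exprn_ge0 ?(ltW r0)//.
  exact: ltW.
exact: mono (step k).
Qed.
End Boost.

(** * The law of the random trees *)

Section Law.
Variable R : realType.
Context (d : measure_display) (Omega : measurableType d) (P : probability Omega R).
Local Open Scope ereal_scope.

Lemma measure_partition (E : finType) (X : Omega -> E) (B : set Omega) :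
  Defs.discrete_measurable X -> measurable B ->
  P B = \sum_(e : E) P (B `&` X @^-1` [set e]).
Proof.
move=> mX mB.
have part (r : seq E) : uniq r ->
    P (B `&` [set w | X w \in r]) = \sum_(e <- r) P (B `&` X @^-1` [set e]).
  elim: r => [_|e r IH /= /andP[er ur]].
    by rewrite big_nil (_ : _ `&` _ = set0) ?measure0// -subset0 => w [].
  rewrite big_cons -IH// -measureU.
  - by rewrite -setIUr; congr (P (_ `&` _)); apply/seteqP; split => w /=;
      rewrite inE; [case/orP => [/eqP|]; [left|right]|case=> [->|->]; rewrite ?eqxx ?orbT].
  - by apply: measurableI => //; exact: (mX [set e]).
  - by apply: measurableI => //; exact: (mX [set` r]).
  - by rewrite -subset0 => w [[_ /= Xe] [_ /=]]; rewrite Xe (negbTE er).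
rewrite -big_enum -part ?enum_uniq//; congr (P _).
by apply/seteqP; split => [w Bw|w []//]; split => //=; rewrite mem_enum.
Qed.

Fixpoint attached (c : nat -> nat) (n : nat) : rtree nat :=
  if n is m.+1 then grow (c m) m.+1 (attached c m) else Leaf 0%N.

Definition labelled (n : nat) (t : rtree nat) : Prop :=
  perm_eq (vertices t) (iota 0 n.+1).

Lemma labelled_uniq n t : labelled n t -> uniq (vertices t).
Proof. by move/perm_uniq ->; exact: iota_uniq. Qed.

Lemma labelled_mem n t v : labelled n t -> (v \in vertices t) = (v < n.+1)%N.
Proof. by move/perm_mem ->; rewrite mem_iota. Qed.

Lemma labelled_grow n t v : labelled n t -> (v < n.+1)%N -> labelled n.+1 (grow (v : nat) n.+1 t).
Proof.
move=> nt vn; have ut := labelled_uniq nt.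
apply: (perm_trans (vertices_grow _ ut _)); first by rewrite (labelled_mem _ nt).
have -> : iota 0 n.+2 = rcons (iota 0 n.+1) n.+1 by rewrite -cats1 -(iotaD 0 n.+1 1) addn1.
by rewrite perm_sym perm_rcons perm_cons perm_sym.
Qed.

Lemma attached_labelled c n : (forall m, (c m <= m)%N) -> labelled n (attached c n).
Proof.
move=> cm; elim: n => [|n IH]; first exact: perm_refl.
by apply: labelled_grow => //; rewrite ltnS.
Qed.

Lemma attached_ext c c' n : (forall m, (m < n)%N -> c m = c' m) ->
  attached c n = attached c' n.
Proof.
elim: n => [//|n IH] cc /=; rewrite cc// IH// => m mn; apply: cc; exact: ltnW.
Qed.

Definition edge_rel (n : nat) (t : rtree nat) : 'I_n -> 'I_n -> bool :=
  fun x y => edge t x y.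

Lemma attachE (n : nat) (t : rtree nat) (v : 'I_n.+1) : labelled n t ->
  attach (@edge_rel n.+1 t) v = @edge_rel n.+2 (grow (v : nat) n.+1 t).
Proof.
move=> nt; have ut := labelled_uniq nt.
have out x : edge t n.+1 x = false /\ edge t x n.+1 = false.
  by split; apply/negP => /edge_vertices[]; rewrite !(labelled_mem _ nt) ltnn.
apply/funext => x; apply/funext => y; rewrite /attach /edge_rel edge_grow//; last first.
  by rewrite (labelled_mem _ nt).
have max m : nat_of_ord (@ord_max m) = m by [].
have old m (z : 'I_m.+1) : nat_of_ord (lift ord_max z) = z by rewrite /= /bump leqNgt ltn_ord.
have ne m (z : 'I_m) : (z == m :> nat) = false by rewrite ltn_eqF.
case: (unliftP ord_max x) => [x' ->|->]; case: (unliftP ord_max y) => [y' ->|->];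
  rewrite ?max ?old ?ne ?eqxx ?andbF ?andbT ?orbF//=.
- by have [_ ->] := out x'.
- by have [-> _] := out y'.
- by have [-> _] := out n.+1; rewrite gtn_eqF.
Qed.

Fixpoint lmean (k : nat) (F : rtree nat -> R) (n : nat) (t : rtree nat) : R :=
  if k is k'.+1 then
    (n.+1%:R^-1 * \sum_(v < n.+1) lmean k' F n.+1 (grow (v : nat) n.+1 t))%R
  else F t.

Lemma lmean_sum (I : finType) (a : I -> R) (F : I -> rtree nat -> R) k n t :
  lmean k (fun t => \sum_i a i * F i t)%R n t = (\sum_i a i * lmean k (F i) n t)%R.
Proof.
elim: k n t => [//|k IH] n t /=.
under eq_bigr => v _ do rewrite IH.
rewrite exchange_big mulr_sumr; apply: eq_bigr => i _ /=.
by rewrite -mulr_sumr mulrCA.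
Qed.

(** Forgetting the labels turns a uniformly chosen vertex into a uniformly chosen
    leaf of the shape. *)
Lemma mean_le_lmean (F : rtree unit -> R) (F' : rtree nat -> R) k n t : labelled n t ->
  (forall t', labelled (n + k) t' -> F (shape t') <= F' t')%R ->
  (mean k F (shape t) <= lmean k F' n t)%R.
Proof.
elim: k n t => [|k IH] n t nt FF' /=; first by apply: FF'; rewrite addn0.
have ut := labelled_uniq nt.
have sz : size (growths (shape t)) = n.+1.
  by rewrite size_growths order_shape /order (perm_size nt) size_iota.
rewrite sz ler_pM2l ?invr_gt0//.
rewrite -(shape_grow n.+1 ut) big_map (perm_big _ nt).
rewrite -[iota 0 n.+1]/(index_iota 0 n.+1) big_mkord; apply: ler_sum => v _.
by apply: IH => [|t' nt']; [exact: labelled_grow|apply: FF'; rewrite addnS].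
Qed.

Variable v : forall n, Omega -> 'I_n.+1.
Hypothesis mv : forall n, Defs.discrete_measurable (v n).
Hypothesis uv : forall n, uniformly_distributed P (v n).
Hypothesis iv : mutually_independent P v.

Definition choices (w : Omega) (n : nat) : nat := v n w.

Definition starts (c : nat -> nat) (n : nat) : set Omega :=
  [set w | forall i, (i < n)%N -> choices w i = c i].

Lemma starts_bigcap c n : starts c n =
  \bigcap_(i in [set` iota 0 n]) (v i @^-1` [set x : 'I_i.+1 | x = c i :> nat]).
Proof.
apply/seteqP; split => w /= h i; last by move=> ni; apply: h; rewrite /= mem_iota.
by rewrite /= mem_iota add0n => ni; exact: h.
Qed.

Lemma measurable_starts c n : measurable (starts c n).
Proof.
rewrite starts_bigcap; apply: fin_bigcap_measurable => // i _.
exact: (mv _).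
Qed.

Lemma starts_prob c n : (forall i, (i < n)%N -> (c i <= i)%N) ->
  P (starts c n) = (\prod_(i < n) i.+1%:R^-1)%R%:E.
Proof.
move=> cn; rewrite starts_bigcap (iv (fun i => [set x : 'I_i.+1 | x = c i :> nat]) (iota_uniq 0 n)).
have -> : iota 0 n = index_iota 0 n by rewrite /index_iota subn0.
rewrite big_mkord.
rewrite (eq_bigr (fun i : 'I_n => (i.+1%:R^-1)%:E)) => [|i _].
  by elim/big_ind2: _ => // x a y b -> ->.
have ci : (c i < i.+1)%N by rewrite ltnS cn.
rewrite (_ : [set x : 'I_i.+1 | x = c i :> nat] = [set Ordinal ci]); first by rewrite uv card_ord.
by apply/seteqP; split => [x xc|x ->//]; apply/val_inj.
Qed.

Lemma measurable_attached n (A : set (rtree nat)) :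
  measurable [set w | A (attached (choices w) n)].
Proof.
elim: n A => [|n IH] A /=.
  have [A0|nA0] := pselect (A (Leaf 0%N)).
    by rewrite (_ : mkset _ = setT)//; apply/seteqP; split.
  by rewrite (_ : mkset _ = set0)//; apply/seteqP; split.
rewrite (_ : mkset _ = \bigcup_(i in [set: 'I_n.+1]) (v n @^-1` [set i] `&`
    [set w | A (grow (i : nat) n.+1 (attached (choices w) n))])); last first.
  apply/seteqP; split => [w Aw|w [i _ [/= <-]]//].
  by exists (v n w).
apply: fin_bigcup_measurable => // i _; apply: measurableI; first exact: (mv _).
exact: (IH [set t | A (grow (i : nat) n.+1 t)]).
Qed.

(** Given the first [n] choices, the later ones are still uniform and independent.
    The induction splits on the next choice, so that it uses only the joint law of
    initial segments of the choices. *)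
Lemma starts_attached (A : set (rtree nat)) k n c :
  (forall i, (i < n)%N -> (c i <= i)%N) ->
  P (starts c n `&` [set w | A (attached (choices w) (n + k))]) =
  P (starts c n) * (lmean k (fun t => (`[< A t >])%:R) n (attached c n))%:E.
Proof.
elim: k n c => [|k IH] n c cn /=.
  rewrite addn0; case: asboolP => [At|nAt].
    rewrite mule1; congr (P _); apply/seteqP; split => [w []//|w cw]; split => //=.
    by rewrite (@attached_ext _ c).
  rewrite mule0 -(measure0 P); congr (P _); rewrite -subset0 => w [cw].
  by rewrite /= (@attached_ext _ c).
have mA : measurable (starts c n `&` [set w | A (attached (choices w) (n + k.+1))]).
  by apply: measurableI; [exact: measurable_starts|exact: measurable_attached].
rewrite (measure_partition (@mv n) mA).
pose c' (u : 'I_n.+1) i : nat := if i == n then (u : nat) else c i.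
have c'c u i : (i < n)%N -> c' u i = c i by move=> ni; rewrite /c' ltn_eqF.
have c'n u i : (i < n.+1)%N -> (c' u i <= i)%N.
  rewrite ltnS leq_eqVlt => /predU1P[->|ni]; first by rewrite /c' eqxx -ltnS.
  by rewrite c'c// cn.
have st u : starts c n `&` [set w | A (attached (choices w) (n + k.+1))] `&` v n @^-1` [set u]
    = starts (c' u) n.+1 `&` [set w | A (attached (choices w) (n.+1 + k))].
  rewrite addSnnS; apply/seteqP; split => w /=.
    move=> [[cw Aw] vu]; split => // i; rewrite ltnS leq_eqVlt => /predU1P[->|ni].
      by rewrite /c' eqxx /choices vu.
    by rewrite c'c// cw.
  move=> [cw Aw]; split.
    by split => // i ni; rewrite cw ?c'c// ltnW.
  by apply/val_inj; have := cw n (ltnSn n); rewrite /c' eqxx.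
rewrite (eq_bigr (fun u : 'I_n.+1 => P (starts c n) * ((n.+1%:R^-1 *
    lmean k (fun t => (`[< A t >])%:R) n.+1 (grow (u : nat) n.+1 (attached c n)))%R)%:E)) => [|u _].
  rewrite starts_prob// -EFinM sumEFin !mulr_sumr.
  by congr EFin; apply: eq_bigr => u _; rewrite mulrA.
rewrite st IH; last exact: c'n.
rewrite !starts_prob//; last exact: c'n.
rewrite big_ord_recr/= EFinM -!muleA; congr (_ * _); rewrite -EFinM.
rewrite /c' /= eqxx; congr (_ * lmean _ _ _ (grow _ _ _))%R%:E.
by apply: attached_ext => m mn; rewrite ltn_eqF.
Qed.

Lemma attached_law (A : set (rtree nat)) n :
  P [set w | A (attached (choices w) n)] =
  (lmean n (fun t => (`[< A t >])%:R) 0 (Leaf 0%N))%:E.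
Proof.
have := @starts_attached A n 0%N (fun=> 0%N) (fun _ _ => leq0n _).
rewrite add0n (_ : starts _ 0 = setT); last by apply/seteqP; split.
by rewrite setTI probability_setT mul1e.
Qed.
End Law.

Section TwoTrees.
Variable R : realType.
Context (d : measure_display) (Omega : measurableType d) (P : probability Omega R).
Local Open Scope ereal_scope.

Lemma uniform_attachment_law (T : forall n, Omega -> 'I_n -> 'I_n -> bool) :
  uniform_attachment_tree P T -> forall n (A : set ('I_n.+1 -> 'I_n.+1 -> bool)),
  measurable (T n.+1 @^-1` A) /\
  P (T n.+1 @^-1` A) =
    (lmean n (fun t => (`[< A (@edge_rel n.+1 t) >])%:R) 0 (Leaf 0%N))%:E.
Proof.
move=> [v [mv uv iv T1 TS]] n A.
have lab w k : labelled k (attached (choices v w) k).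
  by apply: attached_labelled => m; rewrite -ltnS /choices.
have TE k w : T k.+1 w = @edge_rel k.+1 (attached (choices v w) k).
  elim: k => [|k IH]; first by rewrite T1.
  by rewrite TS IH attachE.
have -> : T n.+1 @^-1` A = [set w | (A \o @edge_rel n.+1) (attached (choices v w) n)].
  by apply/seteqP; split => w /=; rewrite TE.
split; first exact: measurable_attached.
by rewrite (attached_law mv uv iv).
Qed.

(** Only the two trees are known to be independent, not the choices that built them;
    hence the sum over the finitely many values of the first tree. *)
Lemma two_trees_law (T1 T2 : forall n, Omega -> 'I_n -> 'I_n -> bool) (n : nat)
    (Q : ('I_n.+1 -> 'I_n.+1 -> bool) -> ('I_n.+1 -> 'I_n.+1 -> bool) -> Prop) :
  uniform_attachment_tree P T1 -> uniform_attachment_tree P T2 ->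
  independent P (T1 n.+1) (T2 n.+1) ->
  measurable [set w | Q (T1 n.+1 w) (T2 n.+1 w)] /\
  P [set w | Q (T1 n.+1 w) (T2 n.+1 w)] =
    (lmean n (fun t2 => lmean n (fun t1 =>
      (`[< Q (@edge_rel n.+1 t1) (@edge_rel n.+1 t2) >])%:R) 0 (Leaf 0%N)) 0 (Leaf 0%N))%:E.
Proof.
move=> h1 h2 ind.
have law1 := uniform_attachment_law h1 (n := n).
have law2 := uniform_attachment_law h2 (n := n).
pose E := {ffun 'I_n.+1 * 'I_n.+1 -> bool}.
pose code (e : 'I_n.+1 -> 'I_n.+1 -> bool) : E := [ffun p => e p.1 p.2].
pose decode (a : E) : 'I_n.+1 -> 'I_n.+1 -> bool := fun x y => a (x, y).
have codeK e : decode (code e) = e.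
  by apply/funext => x; apply/funext => y; rewrite /decode ffunE.
have m1 : Defs.discrete_measurable (code \o T1 n.+1).
  by move=> A; have [] := law1 (code @^-1` A).
pose B a := T1 n.+1 @^-1` (code @^-1` [set a]).
pose C a := T2 n.+1 @^-1` [set e | Q (decode a) e].
have BC a : [set w | Q (T1 n.+1 w) (T2 n.+1 w)] `&` (code \o T1 n.+1) @^-1` [set a] =
    B a `&` C a.
  apply/seteqP; split => w; rewrite /B /C /=.
    by move=> [q wa]; split => //; rewrite -wa codeK.
  by move=> [wa]; rewrite -wa codeK.
have mQ : measurable [set w | Q (T1 n.+1 w) (T2 n.+1 w)].
  rewrite (_ : mkset _ = \bigcup_(a in [set: E]) (B a `&` C a)); last first.
    apply/seteqP; split => [w Qw|w [a _]]; last by rewrite -BC => -[].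
    by exists (code (T1 n.+1 w)) => //; rewrite -BC.
  apply: fin_bigcup_measurable => [|a _]; first exact: finite_finset.
  apply: measurableI; first by have [] := law1 (code @^-1` [set a]).
  by have [] := law2 [set e | Q (decode a) e].
split=> //; rewrite (measure_partition P m1 mQ).
pose pa a := fine (P (B a)).
have PB a : P (B a) = (pa a)%:E.
  by rewrite fineK// fin_num_measure//; have [] := law1 (code @^-1` [set a]).
under eq_bigr => a _.
  rewrite BC ind PB.
  have [_ ->] := law2 [set e | Q (decode a) e].
  rewrite -EFinM; over.
rewrite sumEFin -lmean_sum; congr (lmean _ _ _ _)%:E; apply/funext => t2.
apply: EFin_inj.
have [_ <-] := law1 [set e | Q e (@edge_rel n.+1 t2)].
have [mA _] := law1 [set e | Q e (@edge_rel n.+1 t2)].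
rewrite (measure_partition P m1 mA) -sumEFin; apply: eq_bigr => a _.
rewrite EFinM -PB; case: asboolP => [q|nq].
  rewrite mule1; congr (P _); apply/seteqP; split => w /=; last by case.
  by move=> wa; split => //; move: q; rewrite /= -wa codeK.
rewrite mule0 -(measure0 P); congr (P _); apply/esym; rewrite -subset0 => w [/= q wa].
by apply: nq; rewrite /= -wa codeK.
Qed.

Lemma lcs_prob_ge (T1 T2 : forall n, Omega -> 'I_n -> 'I_n -> bool) (n : nat) (x : R) :
  uniform_attachment_tree P T1 -> uniform_attachment_tree P T2 ->
  independent P (T1 n.+1) (T2 n.+1) ->
  let A := [set w | (x <= (largest_common_subtree (T1 n.+1 w) (T2 n.+1 w))%:R)%R] in
  measurable A /\ (1 - below x n n)%:E <= P A.
Proof.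
move=> h1 h2 ind A.
have [mA ->] := two_trees_law (fun e1 e2 => (x <= (largest_common_subtree e1 e2)%:R)%R) h1 h2 ind.
split=> //; rewrite lee_fin.
pose F t t' : R := (1 - 1 * ((best_match t t')%:R < x)%R%:R)%R.
have -> : (1 - below x n n = rrt n (fun t' => rrt n (F^~ t')))%R.
  rewrite /below -[X in (1 - X)%R]mul1r -rrt_1sub; apply: mean_ext => t'.
  by rewrite /F -rrt_1sub.
have l0 : labelled 0 (Leaf 0%N) by exact: perm_refl.
apply: (mean_le_lmean l0) => t2 l2; apply: (mean_le_lmean l0) => t1 l1.
rewrite /F mul1r; case: asboolP => [_|]; first by case: ltP; rewrite ?subrr ?subr0.
case: ltP => [_ _|xb nx]; first by rewrite subrr.
exfalso; apply: nx; apply: (le_trans xb); rewrite ler_nat.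
have [u1 u2] := (labelled_uniq l1, labelled_uniq l2).
have inordI t : labelled (0 + n) t -> {in vertices t &, injective (@inord n)}.
  move=> lt a b; rewrite !(labelled_mem _ lt) => an bn /(congr1 val) /=.
  by rewrite !inordK.
have inordE t : labelled (0 + n) t -> forall a b, edge t a b ->
    @edge_rel n.+1 t (inord a) (inord b).
  move=> lt a b ab; have [] := edge_vertices ab; rewrite !(labelled_mem _ lt) => an bn.
  by rewrite /edge_rel !inordK.
apply: (common_le_lcs u1 u2 (inordI _ l1) (inordI _ l2) (inordE _ l1) (inordE _ l2)).
exact: best_matchP.
Qed.
End TwoTrees.

(** * Spending the surplus in the exponent *)

Lemma below_le (R : realType) (x y : R) (k k' : nat) :
  x <= y -> below x k k' <= below y k k'.
Proof.
move=> xy; do 2 apply: rrt_le => ?; case: ltP => [mx|_]; last exact: ler0n.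
by rewrite (lt_le_trans mx xy).
Qed.

(** The exponent [5 / 6] exceeds [0.83] by [1 / 300], which beats any constant. *)
Lemma powR_exponent_gap (R : realType) (theta : R) : 0 < theta ->
  exists M : R, forall x, M <= x -> 0 < x ->
    x `^ (83%:R / 100%:R) <= theta * (x * x) `^ (5 / 12).
Proof.
move=> theta0; exists (theta^-1 `^ 300) => x Mx x0.
have [g Eg] : {g : R | g = 1 / 300} by eexists.
have -> : (x * x) `^ (5 / 12) = x `^ (83%:R / 100%:R) * x `^ g.
  rewrite (powRM _ (ltW x0) (ltW x0)) -!powRD; try by rewrite (gt_eqF x0) implybT.
  by congr (_ `^ _); rewrite Eg; lra.
rewrite mulrCA ler_peMr ?powR_ge0// -ler_pdivrMl// mulr1.
have -> : theta^-1 = (theta^-1 `^ 300) `^ g.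
  rewrite -powRrM (_ : 300 * g = 1) ?powRr1 ?invr_ge0 ?ltW//.
  by rewrite Eg; lra.
apply: ge0_ler_powR; rewrite ?nnegrE ?powR_ge0 ?(ltW x0) ?Mx//.
by rewrite Eg; lra.
Qed.

Theorem theorem1p1 (R : realType) (d : measure_display)
    (Omega : measurableType d) (P : probability Omega R)
    (T1 T2 : forall n : nat, Omega -> rel 'I_n)
    (hT1 : uniform_attachment_tree P T1)
    (hT2 : uniform_attachment_tree P T2)
    (hindep : forall n : nat, independent P (T1 n) (T2 n)) :
  P [set w : Omega |
      (n%:R : R) `^ (83%:R / 100%:R) <=
        (largest_common_subtree (T1 n w) (T2 n w))%:R] @[n --> \oo]
    --> (1%:E : \bar R).
Proof.
pose A (n : nat) := [set w : Omega | (n%:R : R) `^ (83%:R / 100%:R) <=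
  (largest_common_subtree (T1 n w) (T2 n w))%:R].
suff : P (A n) @[n --> \oo] --> (1%:E : \bar R) by [].
have mA n : measurable (A n.+1).
  by have [] := lcs_prob_ge (n.+1%:R `^ (83%:R / 100%:R)) hT1 hT2 (hindep n.+1).
apply/fine_cvgP; split.
  exists 1%N => // -[//|n] _ /=; exact: fin_num_measure.
apply/cvgrPdist_le => e e0.
have [theta [X0 [theta0 X00 low]]] := rarely_below_all e0.
have [M Mx] := powR_exponent_gap theta0.
exists (Num.truncn (Num.max X0 M)).+1 => // -[//|n] /= nM.
have nX : Num.max X0 M <= n.+1%:R.
  by apply: ltW; apply: (lt_le_trans (truncnS_gt _)); rewrite ler_nat.
move: nX; rewrite ge_max => /andP[nX nM'].
have [_ PA] := lcs_prob_ge (n.+1%:R `^ (83%:R / 100%:R)) hT1 hT2 (hindep n.+1).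
have PA1 : (P (A n.+1) <= 1)%E by exact: probability_le1.
have fA : P (A n.+1) \is a fin_num by exact: fin_num_measure.
move: PA PA1; rewrite -/(A n.+1) -(fineK fA) !lee_fin => PA PA1.
rewrite ger0_norm ?subr_ge0//.
have := low _ n n nX (lexx _) (lexx _).
have := below_le n n (Mx _ nM' (ltr0Sn _ n)).
lra.
Qed.
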